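(* Let $(S,\mathcal{A},\mu)$ be a complete $\sigma$-finite measure space and let $X$ be a Banach space. Then the following statements are equivalent: (i) The space $L_1(\mu,X)$ has the weak-DD2P. (ii) The measure $\mu$ is atomless or the Banach space $X$ has the weak-DD2P.
   Context: $L_1(\mu,X)$ is the Lebesgue--Bochner space of (classes of) Bochner integrable functions $S\to X$ with norm $\|f\|=\int_S\|f\|\,d\mu$. An atom of $\mu$ is a measurable set $A$ with $\mu(A)>0$ such that every measurable $B\subseteq A$ satisfies $\mu(B)=0$ or $\mu(A\setminus B)=0$; $\mu$ is atomless if it has no atoms. A Banach space $Z$ (real or complex) with closed unit ball $B_Z$ has the weak-DD2P (weak diametral diameter two property) if for every non-empty relatively weakly open subset $W$ of $B_Z$ there exists $z\in W$ such that $\sup_{y\in V}\|z-y\|=2$ for every relatively weakly open subset $V$ of $B_Z$ with $z\in V$.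
   Formalization: The formal theorem assumes X ≠ {0} and μ(S) > 0; otherwise L_1(μ,X) = {0} fails the weak-DD2P while (ii) can hold (X = {0} with μ atomless, or μ = 0), so the literal equivalence is false there. *)

(* Defs.v *)
From HB Require Import structures.
From mathcomp Require Import all_boot all_order all_algebra generic_quotient.
From mathcomp Require Import ring_quotient complex.
From mathcomp Require Import all_classical all_reals all_analysis.
From mathcomp Require Import measurable_realfun.

Set Implicit Arguments.
Unset Strict Implicit.
Unset Printing Implicit Defensive.

Import Order.TTheory GRing.Theory Num.Theory.
Import numFieldNormedType.Exports.

Local Open Scope classical_set_scope.
Local Open Scope ring_scope.
Local Open Scope quotient_scope.

Variant scalar_kind := RealScalars | ComplexScalars.

Definition scalar_field (R : realType) (s : scalar_kind) : numFieldType :=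
  match s with RealScalars => R | ComplexScalars => R[i] end.

Section scalars.
Context (R : realType) (s : scalar_kind).

Definition scalar_re : scalar_field R s -> R :=
  match s return scalar_field R s -> R with
  | RealScalars => id
  | ComplexScalars => fun z : R[i] => complex.Re z
  end.

Definition scalar_of : R -> scalar_field R s :=
  match s return R -> scalar_field R s with
  | RealScalars => id
  | ComplexScalars => fun r : R => r%:C%C : R[i]
  end.

Lemma scalar_ofK : cancel scalar_of scalar_re.
Proof. by rewrite /scalar_of /scalar_re; case: s. Qed.

Lemma scalar_of0 : scalar_of 0 = 0.
Proof. by rewrite /scalar_of; case: s. Qed.

Lemma scalar_ofD a b : scalar_of (a + b) = scalar_of a + scalar_of b.
Proof. by rewrite /scalar_of; case: s => //=; rewrite rmorphD. Qed.

Lemma scalar_ofM a b : scalar_of (a * b) = scalar_of a * scalar_of b.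
Proof. by rewrite /scalar_of; case: s => //=; rewrite rmorphM. Qed.

Lemma ler_scalar_of a b : (scalar_of a <= scalar_of b) = (a <= b).
Proof. by rewrite /scalar_of; case: s => //=; rewrite lecR. Qed.

Lemma ltr_scalar_of a b : (scalar_of a < scalar_of b) = (a < b).
Proof. by rewrite /scalar_of; case: s => //=; rewrite ltcR. Qed.

Lemma ger0_scalar_reK (a : scalar_field R s) : 0 <= a -> scalar_of (scalar_re a) = a.
Proof.
rewrite /scalar_of /scalar_re; case: s a => //= a a0.
by rewrite RRe_real// ger0_real.
Qed.

Section real_norm.
Context (V : normedModType (scalar_field R s)).

(** A [normedModType] over [R[i]] has its norm in [R[i]] (with values in the
    nonnegative reals); [rnorm] is that norm as an element of [R]. *)
Definition rnorm (v : V) : R := scalar_re `|v|.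

Lemma rnormE v : scalar_of (rnorm v) = `|v|.
Proof. exact: ger0_scalar_reK. Qed.

Lemma rnorm_ge0 v : 0 <= rnorm v.
Proof. by rewrite -ler_scalar_of rnormE scalar_of0. Qed.

Lemma rnorm0 : rnorm 0 = 0.
Proof. by rewrite /rnorm normr0 -scalar_of0 scalar_ofK. Qed.

Lemma rnorm_eq0 v : rnorm v = 0 -> v = 0.
Proof. by move=> v0; apply/eqP; rewrite -normr_eq0 -rnormE v0 scalar_of0. Qed.

Lemma ler_rnormD u v : rnorm (u + v) <= rnorm u + rnorm v.
Proof. by rewrite -ler_scalar_of scalar_ofD !rnormE ler_normD. Qed.

Lemma rnormN v : rnorm (- v) = rnorm v.
Proof. by rewrite /rnorm normrN. Qed.

Lemma rnormZ a v : rnorm (a *: v) = scalar_re `|a| * rnorm v.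
Proof.
rewrite /rnorm normrZ -[in LHS](ger0_scalar_reK (normr_ge0 a)).
by rewrite -[in LHS]rnormE -scalar_ofM scalar_ofK.
Qed.

Lemma ler_dist_rnorm u v : `|rnorm u - rnorm v| <= rnorm (u - v).
Proof.
have h (x y : V) : rnorm x - rnorm y <= rnorm (x - y).
  by rewrite lerBlDr (le_trans _ (ler_rnormD _ _))// subrK.
by rewrite ler_norml h andbT lerNl opprB (le_trans (h _ _))// -rnormN opprB.
Qed.

Lemma cvg_rnorm (u : V^nat) l : u @ \oo --> l -> rnorm \o u @ \oo --> rnorm l.
Proof.
move=> /cvgrPdist_lt ul; apply/cvgrPdist_lt => e e0.
have e0' : 0 < scalar_of e by rewrite -scalar_of0 ltr_scalar_of.
apply: filterS (ul _ e0') => n; rewrite -rnormE ltr_scalar_of.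
exact: le_lt_trans (ler_dist_rnorm _ _).
Qed.

End real_norm.
End scalars.

Section weak_DD2P.
Context (R : realType) (s : scalar_kind) (Z : normedModType (scalar_field R s)).

Definition topological_dual :=
  {phi : {linear Z -> (scalar_field R s)^o} | continuous phi}.

(** [Z] with its weak topology: the coarsest topology making every element of
    the dual continuous *)
Definition weak : Type := @sup_topology Z topological_dual
  (fun phi => Topological.class
    (initial_topology (sval phi : Z -> (scalar_field R s)^o))).
HB.instance Definition _ := Topological.on weak.

Definition unit_ball : set Z := [set z | rnorm z <= 1].

Definition rel_weakly_open (W : set Z) :=
  exists2 U : set Z, @open weak U & W = U `&` unit_ball.

Definition weak_DD2P := forall W, rel_weakly_open W -> W !=set0 ->
  exists2 z, W z & forall V, rel_weakly_open V -> V z ->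
    sup [set rnorm (z - y) | y in V] = 2.

End weak_DD2P.

Section atoms.
Context d (T : measurableType d) (R : realType) (mu : {measure set T -> \bar R}).

Definition atom (A : set T) := [/\ measurable A, (0 < mu A)%E &
  forall B, measurable B -> B `<=` A -> mu B = 0%E \/ mu (A `\` B) = 0%E].

Definition atomless := forall A, ~ atom A.

End atoms.

Section bochner.
Context d (T : measurableType d) (R : realType) (mu : {measure set T -> \bar R}).
Context (s : scalar_kind) (X : normedModType (scalar_field R s)).
Implicit Types (f g : T -> X).

(** X-valued simple functions are required to have a support of finite measure,
    so that they are integrable. *)
Definition mu_simple f := [/\ finite_set (range f),
  forall x, measurable (f @^-1` [set x]) &
  (mu [set t | f t != 0%R] < +oo)%E].

Definition strongly_measurable f := exists f_ : (T -> X)^nat,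
  (forall n, mu_simple (f_ n)) /\ {ae mu, forall t, f_ ^~ t @ \oo --> f t}.

Definition bochner_integrable f := strongly_measurable f /\
  exists f_ : (T -> X)^nat, (forall n, mu_simple (f_ n)) /\
    (fun n => \int[mu]_t (rnorm (f t - f_ n t))%:E)%E @ \oo --> 0%E.

Lemma simple_preimage f A : mu_simple f -> measurable (f @^-1` A).
Proof.
move=> [finf mf _].
rewrite (_ : f @^-1` A = \bigcup_(x in A `&` range f) f @^-1` [set x]).
  by apply: fin_bigcup_measurable => //; exact: finite_setIr.
apply/seteqP; split=> [t At|t [x [Ax _] /= ->//]].
by exists (f t) => //; split => //; exists t.
Qed.

Lemma simple0 : mu_simple (fun=> 0).
Proof.
split.
- by apply: sub_finite_set (finite_set1 (0 : X)) => _ [_ _ <-].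
- by move=> x; rewrite preimage_cst; case: ifPn.
- by rewrite (_ : [set _ | _] = set0) ?measure0//; apply/seteqP; split => t //=; rewrite eqxx.
Qed.

Lemma simpleD f g : mu_simple f -> mu_simple g -> mu_simple (f \+ g).
Proof.
move=> sf sg; have [ff mf muf] := sf; have [fg mg mug] := sg; split.
- apply: sub_finite_set (finite_image2 (fun x y => x + y) ff fg).
  by move=> _ [t _ <-]; exists (f t); [exists t|exists (g t); [exists t|]].
- move=> x; rewrite (_ : _ @^-1` _ =
      \bigcup_(y in range f) (f @^-1` [set y] `&` g @^-1` [set x - y])).
    by apply: fin_bigcup_measurable => // y _; exact: measurableI.
  apply/seteqP; split=> [t /= <-|t [y _ /= [-> ->]]]; last by rewrite addrC subrK.
  by exists (f t); [exists t|split => //=; rewrite addrC addKr].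
- have mfg0 : measurable [set t | f t + g t != 0].
    rewrite (_ : [set _ | _] = \bigcup_(y in range f)
        (f @^-1` [set y] `&` g @^-1` [set z | y + z != 0])).
      apply: fin_bigcup_measurable => // y _.
      by apply: measurableI => //; exact: simple_preimage.
    by apply/seteqP; split=> [t /= fgt|t [y _ /= [->]]//]; exists (f t); [exists t|].
  have mf0 := simple_preimage [set x | x != 0] sf.
  have mg0 := simple_preimage [set x | x != 0] sg.
  apply: (@le_lt_trans _ _ (mu [set t | f t != 0%R] + mu [set t | g t != 0%R])%E).
    apply: le_trans (measureU2 mu mf0 mg0).
    apply: le_measure; rewrite ?inE//; first exact: measurableU.
    move=> t /= fgt; have [f0|] := eqVneq (f t) 0; last by left.
    by right; move: fgt; rewrite f0 add0r.
  exact: lte_add_pinfty.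
Qed.

Lemma simpleZ a f : mu_simple f -> mu_simple (a \*: f).
Proof.
move=> sf; have [ff mf muf] := sf; split.
- apply: sub_finite_set (finite_image ( *:%R a) ff).
  by move=> _ [t _ <-]; exists (f t) => //; exists t.
- by move=> x; exact: (simple_preimage (fun y => a *: y = x) sf).
- apply: le_lt_trans muf; apply: le_measure; rewrite ?inE.
  + exact: (simple_preimage [set y | a *: y != 0] sf).
  + exact: (simple_preimage [set y | y != 0] sf).
  + by move=> t /=; apply: contra_neq => ->; rewrite scaler0.
Qed.

Lemma simple_measurable_rnorm f :
  mu_simple f -> measurable_fun setT (fun t => (rnorm (f t))%:E).
Proof.
move=> sf _ B mB; rewrite setTI.
exact: (simple_preimage (fun x => B (rnorm x)%:E) sf).
Qed.

Lemma strongly_measurableD f g : strongly_measurable f ->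
  strongly_measurable g -> strongly_measurable (f \+ g).
Proof.
move=> [f_ [sf ff]] [g_ [sg gg]]; exists (fun n => f_ n \+ g_ n); split.
  by move=> n; exact: simpleD.
by apply: filterS2 ff gg => t ft gt; exact: cvgD.
Qed.

Lemma strongly_measurableZ a f : strongly_measurable f ->
  strongly_measurable (a \*: f).
Proof.
move=> [f_ [sf ff]]; exists (fun n => a \*: f_ n); split.
  by move=> n; exact: simpleZ.
by apply: filterS ff => t ft; exact: cvgZr.
Qed.

Lemma strongly_measurable_simple f : mu_simple f -> strongly_measurable f.
Proof.
move=> sf; exists (fun=> f); split => //.
by apply: aeW => t; exact: cvg_cst.
Qed.

Section complete.
Hypothesis cmu : measure_is_complete mu.

Lemma strongly_measurable_rnorm f : strongly_measurable f ->
  measurable_fun setT (fun t => (rnorm (f t))%:E).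
Proof.
move=> [f_ [sf [N [mN N0 subN]]]].
pose h n t := ((rnorm (f_ n t))%:E * (\1_(~` N) t)%:E)%E : \bar R.
pose h' t := ((rnorm (f t))%:E * (\1_(~` N) t)%:E)%E : \bar R.
have mh' : measurable_fun setT h'.
  apply: (@emeasurable_fun_cvg _ _ _ _ h) => [n|t _].
    apply: emeasurable_funM; first exact: simple_measurable_rnorm.
    by apply/measurable_EFinP; apply: measurable_indic; exact: measurableC.
  rewrite /h /h' indicE; have [tN|tN] := boolP (t \in ~` N); last first.
    by rewrite mule0; under eq_fun do rewrite mule0; exact: cvg_cst.
  rewrite mule1; under eq_fun do rewrite mule1.
  apply/fine_cvgP; split; first exact: nearW.
  apply: (@cvg_rnorm _ _ _ (f_ ^~ t)); move: tN; rewrite inE => tN.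
  by apply: contrapT => ftN; apply: tN; exact: subN.
apply: (ae_measurable_fun cmu _ mh').
exists N; split => // t /= /not_implyP[_ tN].
apply: contrapT => Nt; apply: tN.
by rewrite /h' indicE mem_set// mule1.
Qed.

Lemma ge0_le_integral_rnormD f g : strongly_measurable f -> strongly_measurable g ->
  (\int[mu]_t (rnorm (f t + g t))%:E <=
   \int[mu]_t (rnorm (f t))%:E + \int[mu]_t (rnorm (g t))%:E)%E.
Proof.
move=> sf sg; rewrite -ge0_integralD//.
- apply: ge0_le_integral => //.
  + by move=> t _; rewrite lee_fin rnorm_ge0.
  + exact: strongly_measurable_rnorm (strongly_measurableD sf sg).
  + by apply: emeasurable_funD; exact: strongly_measurable_rnorm.
  + by move=> t _; rewrite lee_fin ler_rnormD.
- by move=> t _; rewrite lee_fin rnorm_ge0.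
- exact: strongly_measurable_rnorm.
- by move=> t _; rewrite lee_fin rnorm_ge0.
- exact: strongly_measurable_rnorm.
Qed.

Lemma integral_rnormZ a f : strongly_measurable f ->
  (\int[mu]_t (rnorm (a *: f t))%:E =
   (scalar_re `|a|)%:E * \int[mu]_t (rnorm (f t))%:E)%E.
Proof.
move=> sf; rewrite -ge0_integralZl//.
- by apply: eq_integral => t _; rewrite rnormZ EFinM.
- exact: strongly_measurable_rnorm.
- by move=> t _; rewrite lee_fin rnorm_ge0.
- by rewrite lee_fin; exact: (@rnorm_ge0 _ _ (scalar_field R s)^o).
Qed.

Lemma bochner_integrable0 : bochner_integrable (fun=> 0).
Proof.
split; first exact: strongly_measurable_simple simple0.
exists (fun=> fun=> 0); split => [_|]; first exact: simple0.
under eq_fun do under eq_integral do rewrite subrr rnorm0.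
by under eq_fun do rewrite integral0; exact: cvg_cst.
Qed.

Lemma strongly_measurableB f g : strongly_measurable f ->
  strongly_measurable g -> strongly_measurable (fun t => f t - g t).
Proof.
move=> sf sg; rewrite (_ : (fun _ => _) = f \+ (-1) \*: g).
  exact/strongly_measurableD/strongly_measurableZ.
by apply/funext => t /=; rewrite scaleN1r.
Qed.

Lemma bochner_integrableD f g : bochner_integrable f ->
  bochner_integrable g -> bochner_integrable (f \+ g).
Proof.
move=> [mf [f_ [sf ff]]] [mg [g_ [sg gg]]].
split; first exact: strongly_measurableD.
exists (fun n => f_ n \+ g_ n); split => [n|]; first exact: simpleD.
have fg : (fun n => \int[mu]_t (rnorm (f t - f_ n t))%:E +
    \int[mu]_t (rnorm (g t - g_ n t))%:E)%E @ \oo --> 0%E.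
  by rewrite -[0%E]adde0; exact: cvgeD.
apply: (squeeze_cvge (f := fun=> 0%E) _ _ fg); [apply: nearW|exact: cvg_cst] => n.
apply/andP; split.
  by apply: integral_ge0 => t _; rewrite lee_fin rnorm_ge0.
under eq_integral do rewrite /= opprD addrACA.
by apply: ge0_le_integral_rnormD; apply: strongly_measurableB => //;
  exact: strongly_measurable_simple.
Qed.

Lemma bochner_integrableZ a f : bochner_integrable f ->
  bochner_integrable (a \*: f).
Proof.
move=> [mf [f_ [sf ff]]]; split; first exact: strongly_measurableZ.
exists (fun n => a \*: f_ n); split => [n|]; first exact: simpleZ.
have af : ((scalar_re `|a|)%:E * \int[mu]_t (rnorm (f t - f_ n t))%:E)%E
    @[n --> \oo] --> ((scalar_re `|a|)%:E * 0)%E by exact: cvgeZl.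
move: af; rewrite mule0; apply: cvg_trans; apply: near_eq_cvg; apply: nearW => n.
rewrite -integral_rnormZ; last first.
  by apply: strongly_measurableB => //; exact: strongly_measurable_simple.
by apply: eq_integral => t _ /=; rewrite scalerBr.
Qed.

Lemma simple_integral_lty f : mu_simple f ->
  (\int[mu]_t (rnorm (f t))%:E < +oo)%E.
Proof.
move=> sf; have [/finite_seqP[r rE] _ muf] := sf.
pose M := \big[Num.max/0]_(x <- r) rnorm x.
have M0 : 0 <= M by apply: bigmax_ge_id.
have fM t : rnorm (f t) <= M.
  have : range f (f t) by exists t.
  by rewrite rE /= => ftr; exact: (@le_bigmax_seq _ _ _ _ _ _ xpredT).
have mf0 : measurable [set t | f t != 0].
  exact: (simple_preimage [set x | x != 0] sf).
apply: (@le_lt_trans _ _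
    (\int[mu]_t (M%:E * (\1_[set t | f t != 0%R] t)%:E))%E).
  apply: ge0_le_integral => //.
  - by move=> t _; rewrite lee_fin rnorm_ge0.
  - exact: simple_measurable_rnorm.
  - apply: emeasurable_funM; first exact: measurable_cst.
    by apply/measurable_EFinP; exact: measurable_indic.
  - move=> t _; rewrite -EFinM lee_fin indicE.
    have [ft0|ft0] := eqVneq (f t) 0.
      by rewrite ft0 rnorm0 mulr_ge0.
    by rewrite mem_set// mulr1.
rewrite ge0_integralZl_EFin//; last first.
  by apply/measurable_EFinP; exact: measurable_indic.
by rewrite integral_indic// setIT lte_mul_pinfty.
Qed.

Lemma bochner_integrable_lty f : bochner_integrable f ->
  (\int[mu]_t (rnorm (f t))%:E < +oo)%E.
Proof.
move=> [mf [f_ [sf ff]]].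
have /fine_cvgP[[n _ /(_ n (leqnn n)) /= fn] _] := ff.
rewrite (eq_integral (fun t => (rnorm ((f t - f_ n t) + f_ n t))%:E)); last first.
  by move=> t _; rewrite subrK.
apply: le_lt_trans (ge0_le_integral_rnormD _ _) _.
- by apply: strongly_measurableB => //; exact: strongly_measurable_simple.
- exact: strongly_measurable_simple.
- apply: lte_add_pinfty; last exact: simple_integral_lty.
  by move: fn; rewrite fin_numE => /andP[_]; rewrite ltey.
Qed.

End complete.
End bochner.

Section bochner_fun.
Context d (T : measurableType d) (R : realType) (mu : {measure set T -> \bar R}).
Hypothesis cmu : measure_is_complete mu.
Context (s : scalar_kind) (X : normedModType (scalar_field R s)).

(* [cmu] is recorded in the predicate and in the types below because their
   algebraic structures rely on it *)
Definition bochner_pred of measure_is_complete mu : {pred T -> X} :=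
  mem [set f | bochner_integrable mu f].
Notation bochner := (bochner_pred cmu).

Lemma bochner_submod_closed : submod_closed bochner.
Proof.
split; first by rewrite inE; exact: bochner_integrable0.
move=> a f g; rewrite !inE => bf bg.
by apply: bochner_integrableD => //; exact: bochner_integrableZ.
Qed.

HB.instance Definition _ :=
  GRing.isSubmodClosed.Build _ _ bochner bochner_submod_closed.

Record bochner_fun := BochnerFun {
  bochner_val : T -> X ;
  _ : bochner_val \in bochner }.

HB.instance Definition _ := [isSub for bochner_val].
HB.instance Definition _ := [Choice of bochner_fun by <:].
HB.instance Definition _ := [SubChoice_isSubLmodule of bochner_fun by <:].

Lemma bochner_funP (f : bochner_fun) : bochner_integrable mu (val f).
Proof. by have := valP f; rewrite inE. Qed.

Definition null_fun : {pred bochner_fun} :=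
  mem [set f | {ae mu, forall t, val f t = 0}].

Lemma null_fun_submod_closed : submod_closed null_fun.
Proof.
split; first by rewrite inE; exact: aeW.
move=> a f g; rewrite !inE /= => f0 g0.
by apply: filterS2 f0 g0 => t /= ft0 gt0;
  rewrite !fctE ft0 gt0 scaler0 addr0.
Qed.

HB.instance Definition _ :=
  GRing.isSubmodClosed.Build _ _ null_fun null_fun_submod_closed.

(** Classes of Bochner integrable functions modulo equality almost everywhere.
    [{ideal_quot _}] is the quotient of a Z-module by any subgroup. *)
Definition L1 := {ideal_quot null_fun}.
HB.instance Definition _ := GRing.Zmodule.on L1.
HB.instance Definition _ := EqQuotient.on L1.

Lemma L1_eqP (f g : bochner_fun) :
  {ae mu, forall t, val f t = val g t} <-> \pi_L1 f = \pi_L1 g.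
Proof.
have -> : (\pi_L1 f = \pi_L1 g) <-> f - g \in null_fun.
  by rewrite Quotient.idealrBE; split=> [->//|/eqP].
rewrite inE /=; split; apply: filterS => t /=; rewrite !fctE.
  by move=> ->; rewrite subrr.
by move=> /eqP; rewrite subr_eq0 => /eqP.
Qed.

Definition L1_scale (a : scalar_field R s) : L1 -> L1 :=
  lift_op1 L1 (fun f : bochner_fun => a *: f).

Lemma pi_L1_scale a : {morph \pi_L1 : f / a *: f >-> L1_scale a f}.
Proof.
move=> f; unlock L1_scale; apply/L1_eqP.
have /L1_eqP : \pi_L1 (repr (\pi_L1 f)) = \pi_L1 f by rewrite reprK.
by apply: filterS => t /=; rewrite !fctE => ->.
Qed.
Canonical pi_L1_scale_morph a := PiMorph1 (pi_L1_scale a).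

Let L1_scalerA a b f : L1_scale a (L1_scale b f) = L1_scale (a * b) f.
Proof. by elim/quotW: f => f; rewrite !piE scalerA. Qed.

Let L1_scale1r : left_id 1 L1_scale.
Proof. by elim/quotW => f; rewrite !piE scale1r. Qed.

Let L1_scalerDr : right_distributive L1_scale +%R.
Proof. by move=> a; elim/quotW => f; elim/quotW => g; rewrite !piE scalerDr. Qed.

Let L1_scalerDl f : {morph L1_scale^~ f : a b / a + b}.
Proof. by elim/quotW: f => f a b; rewrite !piE scalerDl. Qed.

HB.instance Definition _ := GRing.Zmodule_isLmodule.Build (scalar_field R s) L1
  L1_scalerA L1_scale1r L1_scalerDr L1_scalerDl.

Definition L1_norm (f : L1) : R :=
  fine (\int[mu]_t (rnorm (val (repr f) t))%:E)%E.

Lemma L1_normE (f : bochner_fun) :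
  (L1_norm (\pi_L1 f))%:E = (\int[mu]_t (rnorm (val f t))%:E)%E.
Proof.
rewrite /L1_norm fineK; last first.
  rewrite ge0_fin_numE; last by apply: integral_ge0 => t _; rewrite lee_fin rnorm_ge0.
  exact: bochner_integrable_lty (bochner_funP _).
apply: ge0_ae_eq_integral => //.
- exact: (strongly_measurable_rnorm cmu (bochner_funP _).1).
- exact: (strongly_measurable_rnorm cmu (bochner_funP _).1).
- by move=> t _; rewrite lee_fin rnorm_ge0.
- by move=> t _; rewrite lee_fin rnorm_ge0.
have /L1_eqP : \pi_L1 (repr (\pi_L1 f)) = \pi_L1 f by rewrite reprK.
by apply: filterS => t /= -> .
Qed.

Let L1_normD (f g : L1) : scalar_of s (L1_norm (f + g)) <=
  scalar_of s (L1_norm f) + scalar_of s (L1_norm g).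
Proof.
rewrite -scalar_ofD ler_scalar_of -lee_fin EFinD.
elim/quotW: f => f; elim/quotW: g => g; rewrite -raddfD !L1_normE.
exact: (ge0_le_integral_rnormD cmu (bochner_funP f).1 (bochner_funP g).1).
Qed.

Let L1_normZ (a : scalar_field R s) (f : L1) :
  scalar_of s (L1_norm (a *: f)) = `|a| * scalar_of s (L1_norm f).
Proof.
rewrite -[`|a|](ger0_scalar_reK (normr_ge0 a)) -scalar_ofM; congr scalar_of.
apply: EFin_inj; rewrite EFinM; elim/quotW: f => f.
have -> : a *: \pi_L1 f = \pi_L1 (a *: f) by rewrite /GRing.scale /= !piE.
rewrite !L1_normE; exact: (integral_rnormZ cmu a (bochner_funP f).1).
Qed.

Let L1_norm0_eq0 (f : L1) : scalar_of s (L1_norm f) = 0 -> f = 0.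
Proof.
move=> /(congr1 (@scalar_re R s)); rewrite scalar_ofK -(scalar_of0 R s) scalar_ofK.
elim/quotW: f => f nf0; have f0 : (\int[mu]_t (rnorm (val f t))%:E = 0)%E.
  by rewrite -L1_normE nf0.
have <- : \pi_L1 0 = 0 by rewrite raddf0.
apply/L1_eqP.
have mf : measurable_fun setT (fun t => (rnorm (val f t))%:E).
  exact: (strongly_measurable_rnorm cmu (bochner_funP _).1).
have af0 : (\int[mu]_t `|(rnorm (val f t))%:E| = 0)%E.
  rewrite -f0; apply: eq_integral => t _.
  by rewrite gee0_abs// lee_fin rnorm_ge0.
have := (ae_eq_integral_abs mu measurableT mf).1 af0.
by apply: filterS => t /= /(_ I) [] /rnorm_eq0 ->.
Qed.

HB.instance Definition _ := Lmodule_isNormed.Build (scalar_field R s) L1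
  L1_normD L1_normZ L1_norm0_eq0.

Lemma rnorm_L1 (f : bochner_fun) :
  (rnorm (\pi_L1 f))%:E = (\int[mu]_t (rnorm (val f t))%:E)%E.
Proof. by rewrite -L1_normE /rnorm [in LHS]/Num.norm /= scalar_ofK. Qed.

End bochner_fun.

(* Main.v *)
Require Import Defs.
From HB Require Import structures.
From mathcomp Require Import all_boot all_order all_algebra.
From mathcomp Require Import complex.
From mathcomp Require Import all_classical all_reals all_analysis.
From mathcomp Require Import measurable_realfun.
From mathcomp Require Import ring lra.

(** Call a point [z] of the closed unit ball a DD point if each of its weak
    neighbourhoods contains points of the ball at distance nearly 2 from [z].
    The weak-DD2P says that the DD points are weakly dense in the ball
    ([weak_DD2PE]), and only neighbourhoods cut out by finitely many
    functionals matter.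

    Atomless measure.  Every class [f] of norm one is then a DD point
    ([atomless_DD_point]).  The measure with density [|f|] is atomless as well,
    so the space splits into finitely many pieces [A_j] of tiny mass [lam_j]
    ([atomless_partition]), and [f] is the convex combination with weights
    [lam_j] of the normalised pieces [f 1_{A_j} / lam_j].  For finitely many
    functionals and a tolerance there is a number [m] such that every convex
    combination of vectors of the ball is matched, up to the tolerance, by the
    average of [m] of these vectors ([empirical_approximation]); [m] does not
    depend on the partition.  The average [g] obtained here has norm one and is
    carried by a set of [f]-mass at most [m * max lam_j], so [f] and [g] are
    almost disjoint and [|f - g|] is almost 2.  This gives DD points on the
    unit sphere only, and that is enough: a space with a DD point has no finite
    separating family of functionals, hence every weak neighbourhood of a point
    of the ball meets the sphere ([weak_DD2P_of_sphere]).

    [X] has the weak-DD2P.  A simple function lives in a copy of a weighted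
    l1-sum of finitely many copies of [X], and in that sum a vector of the ball
    is a convex combination of vectors of the balls of the copies.  Replace each
    of them by a nearby DD point of [X]: in an l1-sum distances add up, so the
    convex combination of the DD points is a DD point
    ([weak_DD2P_of_l1_approx]).  Simple functions being dense, this suffices,
    whether the measure has atoms or not.

    Conversely, let [A] be an atom.  It can be taken of finite measure, and
    integrable functions are almost everywhere constant on it, so [X] is an
    L-summand: [L1] is the l1-sum of [X] and a complement ([atom_L_summand]).
    The weak-DD2P passes to L-summands ([L_summand_weak_DD2P]): a DD point [z]
    close to [J x0] with [|x0| = 1] and tested against a functional norming
    [x0] has a small component [y] in the complement; weak lower semicontinuity
    of the norms of the two components, which comes from a functional norming
    [z], shows that far points near [z] are far in each component, so that
    [P z / (1 - |y|)] is a DD point of [X]. *)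

Set Implicit Arguments.
Unset Strict Implicit.
Unset Printing Implicit Defensive.

Import Order.TTheory GRing.Theory Num.Theory.
Import numFieldNormedType.Exports.

Local Open Scope classical_set_scope.
Local Open Scope ring_scope.

(** * Scalars and real-valued norms *)

Section scalars.
Context (R : realType) (s : scalar_kind).
Notation F := (scalar_field R s).

Definition scalar_im : F -> R :=
  match s return scalar_field R s -> R with
  | RealScalars => fun=> 0
  | ComplexScalars => fun z : R[i] => complex.Im z
  end.

Lemma scalar_of1 : scalar_of s (1 : R) = 1.
Proof. by rewrite /scalar_of; case: s. Qed.

Lemma scalar_of_nat (n : nat) : scalar_of s (n%:R : R) = n%:R.
Proof.
elim: n => [|n IH]; first exact: scalar_of0.
by rewrite -!natr1 scalar_ofD IH scalar_of1.
Qed.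

Lemma scalar_ofN (a : R) : scalar_of s (- a) = - scalar_of s a.
Proof. by rewrite /scalar_of; case: s => //=; rewrite rmorphN. Qed.

Lemma scalar_of_eq0 (a : R) : (scalar_of s a == 0) = (a == 0).
Proof. by rewrite -(scalar_of0 R s) (inj_eq (can_inj (@scalar_ofK R s))). Qed.

Lemma scalar_re_normr_of (a : R) : scalar_re `|scalar_of s a| = `|a|.
Proof.
wlog a0 : a / 0 <= a => [h|].
  have [/h//|a0] := leP 0 a.
  by rewrite -normrN -scalar_ofN h ?normrN// oppr_ge0 ltW.
by rewrite ger0_norm ?scalar_ofK ?ger0_norm// -(scalar_of0 R s) ler_scalar_of.
Qed.

Lemma scalar_reD (a b : F) : scalar_re (a + b) = scalar_re a + scalar_re b.
Proof. by move: a b; rewrite /scalar_re; case: s => //= -[? ?] [? ?]. Qed.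

Lemma scalar_reN (a : F) : scalar_re (- a) = - scalar_re a.
Proof. by move: a; rewrite /scalar_re; case: s => //= -[? ?]. Qed.

Lemma scalar_reB (a b : F) : scalar_re (a - b) = scalar_re a - scalar_re b.
Proof. by rewrite scalar_reD scalar_reN. Qed.

Lemma scalar_reM (c : R) (a : F) : scalar_re (scalar_of s c * a) = c * scalar_re a.
Proof.
move: a; rewrite /scalar_re /scalar_of; case: s => //= -[? ?] /=.
by rewrite mul0r subr0.
Qed.

Lemma scalar_imD (a b : F) : scalar_im (a + b) = scalar_im a + scalar_im b.
Proof. by move: a b; rewrite /scalar_im; case: s => [? ?|[? ?] [? ?]]//; rewrite addr0. Qed.

Lemma scalar_imM (c : R) (a : F) : scalar_im (scalar_of s c * a) = c * scalar_im a.
Proof.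
move: a; rewrite /scalar_im /scalar_of; case: s => [?|[? ?]] /=; first by rewrite mulr0.
by rewrite mul0r addr0.
Qed.

Lemma normr_scalar_re (a : F) : `|scalar_re a| <= rnorm (a : F^o).
Proof.
move: a; rewrite /rnorm /scalar_re; case: s => //= -[a b] /=.
by rewrite -sqrtr_sqr ler_wsqrtr// lerDl sqr_ge0.
Qed.

Lemma normr_scalar_im (a : F) : `|scalar_im a| <= rnorm (a : F^o).
Proof.
move: a; rewrite /rnorm /scalar_re /scalar_im; case: s => /= [z|[a b]] /=.
  by rewrite normr0.
by rewrite -sqrtr_sqr ler_wsqrtr// lerDr sqr_ge0.
Qed.

Lemma rnorm_scalar_le (a : F) : rnorm (a : F^o) <= `|scalar_re a| + `|scalar_im a|.
Proof.
move: a; rewrite /rnorm /scalar_re /scalar_im; case: s => /= [z|[a b]].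
  by rewrite normr0 addr0.
rewrite -[X in X <= _]ger0_norm ?sqrtr_ge0//.
rewrite -(@ler_pXn2r _ 2) ?nnegrE ?normr_ge0 ?addr_ge0//.
rewrite real_normK ?num_real// sqr_sqrtr ?addr_ge0 ?sqr_ge0//.
rewrite sqrrD !real_normK ?num_real// lerD2r lerDl.
by rewrite mulrn_wge0// mulr_ge0.
Qed.

End scalars.

Section real_scaling.
Context (R : realType) (s : scalar_kind) (V : normedModType (scalar_field R s)).

Lemma rnormZ_of (a : R) (v : V) : rnorm (scalar_of s a *: v) = `|a| * rnorm v.
Proof. by rewrite rnormZ scalar_re_normr_of. Qed.

Lemma rnorm_distC (u v : V) : rnorm (u - v) = rnorm (v - u).
Proof. by rewrite -rnormN opprB. Qed.

Lemma rnorm_sum (I : Type) (r : seq I) (P : pred I) (v : I -> V) :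
  rnorm (\sum_(i <- r | P i) v i) <= \sum_(i <- r | P i) rnorm (v i).
Proof.
elim/big_ind2 : _ => //; first by rewrite rnorm0.
by move=> x a y b xa yb; apply: le_trans (ler_rnormD _ _) (lerD xa yb).
Qed.

End real_scaling.

Section bounded_linear.
Context (R : realType) (s : scalar_kind) (V W : normedModType (scalar_field R s)).

Lemma bounded_continuous (f : {linear V -> W}) (C : R) :
  (forall x, rnorm (f x) <= C * rnorm x) -> continuous f.
Proof.
move=> fC; apply: bounded_linear_continuous; apply/linear_boundedP.
near=> r => x; apply: (@le_trans _ _ (scalar_of s C * `|x|)).
  by rewrite -!rnormE -scalar_ofM ler_scalar_of.
apply: ler_wpM2r => //; near: r; apply: nbhs_pinfty_ge.
by rewrite /scalar_of; case: (s) => //=; rewrite ?num_real// complex_real.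
Unshelve. all: by end_near. Qed.

Lemma continuous_bounded (f : {linear V -> W}) : continuous f ->
  exists2 C : R, 0 < C & forall x, rnorm (f x) <= C * rnorm x.
Proof.
move=> /(_ 0)/(@continuous_linear_bounded _ _ _ 0)/linear_boundedP.
move=> /pinfty_ex_gt0[M M0 fM].
exists (scalar_re M).
  by rewrite -(ltr_scalar_of s) scalar_of0 ger0_scalar_reK// ltW.
move=> x; rewrite -(ler_scalar_of s) scalar_ofM !rnormE ger0_scalar_reK; last exact: ltW.
exact: fM.
Qed.

End bounded_linear.

(** * Basic weak neighbourhoods and diametral points *)

Section weak_neighbourhoods.
Context (R : realType) (s : scalar_kind) (Z : normedModType (scalar_field R s)).
Notation F := (scalar_field R s).
Notation dual := (topological_dual Z).

(** Indexing by arbitrary finite types lets families of functionals be joined by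
    sums and options of index types. *)
Definition weak_nbhd (I : finType) (phi : I -> dual) (e : R) (z : Z) : set Z :=
  [set y | forall i, rnorm (sval (phi i) (y - z) : F^o) < e].

Lemma nbhs_scalar_ball (a : F^o) (e : R) : 0 < e ->
  nbhs a [set b : F^o | rnorm (b - a) < e].
Proof.
move=> e0; have e0' : 0 < scalar_of s e by rewrite -(scalar_of0 R s) ltr_scalar_of.
apply: filterS (@nbhsx_ballx _ F^o a _ e0') => b; rewrite -ball_normE /=.
by rewrite distrC -rnormE ltr_scalar_of.
Qed.

Lemma scalar_ball_sub (a : F^o) (A : set F^o) : nbhs a A ->
  exists2 e : R, 0 < e & [set b : F^o | rnorm (b - a) < e] `<=` A.
Proof.
move=> /nbhs_ballP[e /= e0 eA]; exists (scalar_re e).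
  by rewrite -(ltr_scalar_of s) scalar_of0 ger0_scalar_reK// ltW.
move=> b /= be; apply: eA; rewrite -ball_normE /= distrC -rnormE.
by rewrite -[e](ger0_scalar_reK (ltW e0)) ltr_scalar_of.
Qed.

Lemma weak_nbhd_nbhs (I : finType) (phi : I -> dual) (e : R) (z : Z) : 0 < e ->
  @nbhs _ (weak Z) z (weak_nbhd phi e z).
Proof.
move=> e0; have := @filter_forall (weak Z) I
  (fun i => [set y | rnorm (sval (phi i) (y - z) : F^o) < e])
  (@nbhs _ (weak Z) z) _; apply => i.
have /cvg_sup/(_ (phi i)) h : @nbhs _ (weak Z) z --> (z : weak Z) by [].
have N := @initial_continuous Z F^o (sval (phi i)) z _
  (nbhs_scalar_ball (sval (phi i) z) e0).
have := h _ N; rewrite nbhs_simpl; apply: filterS => y /=.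
by rewrite linearB.
Qed.

(** The supersets of basic neighbourhoods form a filter that converges to [z]
    for each of the initial topologies, hence for their supremum. *)
Lemma weak_nbhd_sub (U : set Z) (z : Z) : @nbhs _ (weak Z) z U ->
  exists (I : finType) (phi : I -> dual) (e : R),
    0 < e /\ weak_nbhd phi e z `<=` U.
Proof.
pose G := [set A : set Z | exists (I : finType) (phi : I -> dual) (e : R),
   0 < e /\ weak_nbhd phi e z `<=` A].
have FG : Filter G.
  split.
  - by exists void, (of_void _), 1.
  - move=> A B [I [phi [e [e0 eA]]]] [J [psi [e' [e'0 eB]]]].
    exists (I + J)%type, (fun x : I + J => match x with inl i => phi i | inr j => psi j end).
    exists (Num.min e e'); split; first by rewrite lt_min e0.
    move=> y yz; split; [apply: eA => i|apply: eB => j].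
      by have := yz (inl i); rewrite lt_min => /andP[].
    by have := yz (inr j); rewrite lt_min => /andP[].
  - move=> A B AB [I [phi [e [e0 eA]]]]; exists I, phi, e; split => //.
    exact: subset_trans AB.
move: U; have := (@cvg_sup Z dual (fun phi => Topological.class
  (initial_topology (sval phi : Z -> F^o))) G z FG).2; apply => phi A.
rewrite nbhsE => -[B [[C Copen <-] Cz] BA].
have [e e0 eC] := scalar_ball_sub (open_nbhs_nbhs (conj Copen Cz)).
exists unit, (fun=> phi), e; split => // y /(_ tt) /= yz.
by apply: BA; apply: eC; rewrite /= -linearB.
Qed.

(** Distances in the unit ball are at most 2, so only the lower bound on the
    supremum carries information. *)
Lemma sup_norm_eq2P (z : Z) (V : set Z) : rnorm z <= 1 -> V z ->
  V `<=` @unit_ball R s Z ->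
  sup [set rnorm (z - y) | y in V] = 2 <->
  forall e, 0 < e -> exists2 y, V y & 2 - e < rnorm (z - y).
Proof.
move=> z1 Vz V1.
have ub : ubound [set rnorm (z - y) | y in V] 2.
  move=> _ [y Vy <-]; apply: le_trans (ler_rnormD _ _) _; rewrite rnormN.
  by have := V1 _ Vy; rewrite /unit_ball /=; lra.
have hs : has_sup [set rnorm (z - y) | y in V].
  by split; [exists (rnorm (z - z)), z|exists 2].
split=> [sup2 e e0|h].
  by have [_ [y Vy <-]] := sup_adherent e0 hs; rewrite sup2; exists y.
apply/eqP; rewrite eq_le ge_sup//=; last by case: hs.
apply/ler_addgt0Pl => e /h [y Vy ye].
rewrite addrC -lerBlDr; apply: le_trans (ltW ye) _.
by apply: ub_le_sup; [exists 2|exists y].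
Qed.

Definition DD_point (z : Z) := rnorm z <= 1 /\
  forall (I : finType) (phi : I -> dual) (e : R), 0 < e ->
  exists y, [/\ rnorm y <= 1, weak_nbhd phi e z y & 2 - e < rnorm (z - y)].

Lemma weak_DD2PE : weak_DD2P Z <->
  forall (I : finType) (phi : I -> dual) (e : R) z0, 0 < e -> rnorm z0 <= 1 ->
  exists2 z, DD_point z & weak_nbhd phi e z0 z.
Proof.
have nbhd_rel (I : finType) (phi : I -> dual) (e : R) z (e0 : 0 < e) :
    @rel_weakly_open _ _ Z ((@interior (weak Z) (weak_nbhd phi e z)) `&` @unit_ball _ _ Z).
  exists (@interior (weak Z) (weak_nbhd phi e z)) => //; exact: open_interior.
split.
- move=> dd I phi e z0 e0 z01.
  have [|z [zW z1] zDD] := dd _ (nbhd_rel I phi e z0 e0).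
    by exists z0; split => //; exact: weak_nbhd_nbhs.
  have zz := nbhs_singleton zW.
  exists z => //; split => // J psi e' e'0.
  have Vz : (@interior (weak Z) (weak_nbhd psi e' z) `&` @unit_ball _ _ Z) z.
    by split => //; exact: weak_nbhd_nbhs.
  have /sup_norm_eq2P := zDD _ (nbhd_rel J psi e' z e'0) Vz.
  move=> /(_ z1 Vz (@subIsetr _ _ _) _ e'0)[y [yV y1] ze].
  by exists y; split => //; exact: nbhs_singleton yV.
- move=> h W [U Uo ->] [z0 [Uz0 z01]].
  have [I [phi [e [e0 eU]]]] : exists (I : finType) (phi : I -> dual) (e : R),
      0 < e /\ weak_nbhd phi e z0 `<=` U.
    by apply: weak_nbhd_sub; exact: open_nbhs_nbhs.
  have [z [z1 zDD] /eU Uz] := h I phi e z0 e0 z01.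
  exists z => // _ [V Vo ->] [Vz _]; apply/sup_norm_eq2P => // e' e'0.
  have [J [psi [e1 [e10 eV]]]] : exists (I : finType) (phi : I -> dual) (e : R),
      0 < e /\ weak_nbhd phi e z `<=` V.
    by apply: weak_nbhd_sub; exact: open_nbhs_nbhs.
  have [|y [y1 zy ye]] := zDD J psi (Num.min e' e1).
    by rewrite lt_min e'0.
  exists y.
    split => //; apply: eV => j; apply: lt_le_trans (zy j) _.
    by rewrite ge_min lexx orbT.
  by apply: le_lt_trans ye; rewrite lerD2l lerN2 ge_min lexx.
Qed.

End weak_neighbourhoods.

(** * The Hahn-Banach theorem for real and complex normed spaces *)

Section hahn_banach.
Context (R : realType) (s : scalar_kind) (V : normedModType (scalar_field R s)).
Notation sc := (scalar_of s).

(** Partial real-linear functionals dominated by the norm are encoded by their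
    graphs, so that chains have plain unions as upper bounds; domination makes
    such a linear relation single-valued ([dominated_graph_fun]). *)
Definition dominated_graph (G : set (V * R)) :=
  (forall a p q, G p -> G q -> G (sc a *: p.1 + q.1, a * p.2 + q.2)) /\
  (forall p, G p -> p.2 <= rnorm p.1).

Lemma dominated_graph0 G p : dominated_graph G -> G p -> G (0, 0).
Proof.
move=> [GD _] Gp; have := GD (-1) _ _ Gp Gp.
by rewrite scalar_ofN scalar_of1 scaleN1r mulN1r !addNr.
Qed.

Lemma dominated_graphZ G a p : dominated_graph G -> G p ->
  G (sc a *: p.1, a * p.2).
Proof.
move=> dG Gp; have := dG.1 a _ _ Gp (dominated_graph0 dG Gp).
by rewrite !addr0.
Qed.

Lemma dominated_graph_fun G v r r' : dominated_graph G ->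
  G (v, r) -> G (v, r') -> r = r'.
Proof.
move=> dG; have le a b : G (v, a) -> G (v, b) -> a <= b.
  move=> Ga Gb; have := dG.2 _ (dG.1 (-1) _ _ Gb Ga) => /=.
  by rewrite scalar_ofN scalar_of1 scaleN1r addNr rnorm0 mulN1r addrC subr_le0.
by move=> Gr Gr'; apply/eqP; rewrite eq_le !le.
Qed.

(** The classical one-dimensional extension.  The value [c] at [v] must separate
    the numbers [r - |x - v|] from the numbers [|x + v| - r], for [(x, r)] in
    the graph; the triangle inequality says that this is possible. *)
Lemma dominated_graph_extend G v : dominated_graph G -> G !=set0 ->
  exists G', [/\ dominated_graph G', G `<=` G' & exists r, G' (v, r)].
Proof.
move=> dG [p0 Gp0]; have [GD Gle] := dG.
have G0 := dominated_graph0 dG Gp0.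
pose S := [set p.2 - rnorm (p.1 - v) | p in G].
have Sle p q : G p -> G q -> p.2 - rnorm (p.1 - v) <= rnorm (q.1 + v) - q.2.
  move=> Gp Gq; have := Gle _ (GD 1 _ _ Gp Gq).
  rewrite /= scalar_of1 scale1r mul1r => h.
  have := ler_rnormD (p.1 - v) (q.1 + v).
  by rewrite addrACA addNr addr0; lra.
pose c := sup S.
have cge p : G p -> p.2 - rnorm (p.1 - v) <= c.
  move=> Gp; apply: ub_le_sup; last by exists p.
  by exists (rnorm (0 + v) - 0) => _ [q Gq <-]; exact: (Sle q (0, 0)).
have cle q : G q -> c <= rnorm (q.1 + v) - q.2.
  move=> Gq; apply: ge_sup; first by exists (p0.2 - rnorm (p0.1 - v)), p0.
  by move=> _ [p Gp <-]; exact: Sle.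
exists [set (pa.1.1 + sc pa.2 *: v, pa.1.2 + pa.2 * c) | pa in G `*` setT]; split.
- split.
    move=> a _ _ [[p b] [/= Gp _] <-] [[q b'] [/= Gq _] <-] /=.
    exists ((sc a *: p.1 + q.1, a * p.2 + q.2), a * b + b') => /=.
      by split => //; exact: GD.
    congr pair; last by ring.
    rewrite scalar_ofD scalar_ofM scalerDr scalerDl -!scalerA.
    by rewrite addrACA.
  move=> _ [[p b] [/= Gp _] <-] /=.
  have [->|b0] := eqVneq b 0.
    by rewrite scalar_of0 scale0r mul0r !addr0; exact: Gle.
  have sb0 : sc b != 0 by rewrite scalar_of_eq0.
  have Gpb := dominated_graphZ b^-1 dG Gp.
  have [b_lt0|b_gt0|b00] := ltgtP b 0; last by rewrite b00 eqxx in b0.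
  + have Gpb' := dominated_graphZ (- b^-1) dG Gp.
    have := cge _ Gpb'; rewrite /=.
    have -> : sc (- b^-1) *: p.1 - v = sc (- b^-1) *: (p.1 + sc b *: v).
      rewrite scalerDr scalerA -scalar_ofM mulNr mulVf//.
      by rewrite [sc (- 1)]scalar_ofN scalar_of1 scaleN1r.
    rewrite rnormZ_of normrN normfV ltr0_norm// => h.
    have nb : 0 < - b by rewrite oppr_gt0.
    have := ler_wpM2l (ltW nb) h.
    have -> (r N : R) : - b * (- b^-1 * r - (- b)^-1 * N) = r - N.
      by field; rewrite ?oppr_eq0 b0.
    by rewrite mulNr; lra.
  + have := cle _ Gpb; rewrite /=.
    have -> : sc b^-1 *: p.1 + v = sc b^-1 *: (p.1 + sc b *: v).
      by rewrite scalerDr scalerA -scalar_ofM mulVf// scalar_of1 scale1r.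
    rewrite rnormZ_of normfV gtr0_norm// => h.
    have := ler_wpM2l (ltW b_gt0) h.
    have -> (r N : R) : b * (b^-1 * N - b^-1 * r) = N - r by field.
    by lra.
- move=> [x r] Gxr; exists ((x, r), 0) => //=.
  by rewrite scalar_of0 scale0r mul0r !addr0.
- exists c; exists ((0, 0), 1) => //=.
  by rewrite scalar_of1 scale1r mul1r !add0r.
Qed.

Lemma hahn_banach_real (v0 : V) : exists u : V -> R,
  [/\ forall a x y, u (sc a *: x + y) = a * u x + u y,
      forall x, u x <= rnorm x & u v0 = rnorm v0].
Proof.
pose G0 : set (V * R) := [set (sc a *: v0, a * rnorm v0) | a in setT].
have dG0 : dominated_graph G0.
  split.
    move=> a _ _ [b _ <-] [b' _ <-] /=; exists (a * b + b') => //.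
    by rewrite scalar_ofD scalar_ofM scalerDl scalerA mulrDl mulrA.
  move=> _ [a _ <-] /=; rewrite rnormZ_of ler_wpM2r ?rnorm_ge0//.
  exact: ler_norm.
(* the empty union of the empty chain forces the guard [G !=set0] *)
pose P G := G !=set0 -> dominated_graph G /\ G0 `<=` G.
have [|G [PG maxG]] := @Zorn_bigcup _ P.
  move=> F FP Ftot [p [X FX Xp]].
  have PF Y q : F Y -> Y q -> dominated_graph Y /\ G0 `<=` Y.
    by move=> FY Yq; apply: FP => //; exists q.
  split; last first.
    by move=> q /(PF X p FX Xp).2 Xq; exists X.
  split.
    move=> a q r [Y FY Yq] [Y' FY' Yr].
    have [YY'|YY'] := Ftot _ _ FY FY'.
      by exists Y' => //; apply: (PF Y' r FY' Yr).1.1 => //; exact: YY'.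
    by exists Y => //; apply: (PF Y q FY Yq).1.1 => //; exact: YY'.
  by move=> q [Y FY Yq]; exact: (PF Y q FY Yq).1.2.
have G_neq0 : G !=set0.
  apply: contrapT => G0'.
  have GE : G = set0 by apply/eqP; apply/negP => /negP/set0P.
  apply: (maxG G0); last by move=> _; split.
  rewrite GE; split => //; move=> /(_ (v0, rnorm v0)); apply.
  by exists 1 => //; rewrite scalar_of1 scale1r mul1r.
have [dG sG0] := PG G_neq0.
have Gtot v : exists r, G (v, r).
  have [G' [dG' sGG' [r G'r]]] := dominated_graph_extend v dG G_neq0.
  exists r; apply: contrapT => nGr; apply: (maxG G').
    by split => // /(_ _ G'r).
  by move=> _; split => //; exact: subset_trans sGG'.
pose u v := xget 0 [set r | G (v, r)].
have Gu v : G (v, u v) by rewrite /u; case: xgetP => // /(_ _)+; have [r Gr /(_ r)] := Gtot v.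
exists u; split.
- move=> a x y; apply: (dominated_graph_fun dG (Gu _)).
  exact: (dG.1 a _ _ (Gu x) (Gu y)).
- by move=> x; exact: (dG.2 _ (Gu x)).
- apply: (dominated_graph_fun dG (Gu _)); apply: sG0.
  by exists 1 => //; rewrite scalar_of1 scale1r mul1r.
Qed.

End hahn_banach.

(** A complex functional [f] is recovered from its real part [u] as
    [f x = u x - i u (i x)], and continuity follows from the crude estimate
    [|f x| <= |u x| + |u (i x)| <= 2 |x|]. *)
Lemma hahn_banach (R : realType) (s : scalar_kind)
    (V : normedModType (scalar_field R s)) (v0 : V) :
  exists f : topological_dual V,
    (forall x, scalar_re (sval f x) <= rnorm x) /\
    scalar_re (sval f v0) = rnorm v0.
Proof.
have [u [u_lin u_le uv0]] := hahn_banach_real v0.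
have uD x y : u (x + y) = u x + u y.
  by have := u_lin 1 x y; rewrite scalar_of1 scale1r mul1r.
have u0 : u 0 = 0 by apply: (@addrI _ (u 0)); rewrite -uD !addr0.
have uZ a x : u (scalar_of s a *: x) = a * u x.
  by have := u_lin a x 0; rewrite u0 !addr0.
have uN x : u (- x) = - u x.
  by apply: (@addrI _ (u x)); rewrite -uD !subrr.
have u_norm x : `|u x| <= rnorm x.
  by rewrite ler_norml u_le andbT lerNl -uN -(rnormN x) u_le.
suff [f [fu fC]] : exists f : {linear V -> (scalar_field R s)^o},
    (forall x, scalar_re (f x) = u x) /\
    (forall x, rnorm (f x) <= 2 * rnorm x).
  exists (exist _ f (bounded_continuous fC)).
  by split => [x|] /=; rewrite fu.
case: s V v0 u u_lin u_le uv0 uD u0 uZ uN u_norm => V v0 u u_lin u_le uv0 uD u0 uZ uN u_norm.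
- pose u' : V -> (scalar_field R RealScalars)^o := u.
  have u'lin : linear u' by move=> a x y; exact: u_lin.
  pose f := HB.pack_for {linear V -> (scalar_field R RealScalars)^o} u'
    (GRing.isLinear.Build _ _ _ _ u' u'lin).
  exists f; split => // x; rewrite mulr_natl mulr2n.
  by apply: (le_trans (u_norm x)); rewrite lerDl rnorm_ge0.
- pose u' x : (scalar_field R ComplexScalars)^o := (u x +i* - u ('i%C *: x))%C.
  have decomp a b x : (a +i* b)%C *: x =
      scalar_of ComplexScalars a *: x + scalar_of ComplexScalars b *: ('i%C *: x).
    rewrite scalerA -scalerDl; congr (_ *: _).
    by apply/eqP; rewrite eq_complex /=; apply/andP; split; apply/eqP; ring.
  have idecomp a b x : 'i%C *: ((a +i* b)%C *: x) =
      scalar_of ComplexScalars (- b) *: x + scalar_of ComplexScalars a *: ('i%C *: x).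
    rewrite -decomp scalerA; congr (_ *: _).
    by apply/eqP; rewrite eq_complex /=; apply/andP; split; apply/eqP; ring.
  have u'lin : linear u'.
    move=> [a b] x y; apply/eqP; rewrite eq_complex /= scalerDr.
    rewrite idecomp decomp !uD !uZ.
    by apply/andP; split; apply/eqP; rewrite /=; ring.
  pose f := HB.pack_for {linear V -> (scalar_field R ComplexScalars)^o} u'
    (GRing.isLinear.Build _ _ _ _ u' u'lin).
  exists f; split => // x.
  apply: le_trans (rnorm_scalar_le _) _ => /=.
  rewrite normrN mulr_natl mulr2n lerD//.
  apply: le_trans (u_norm _) _; rewrite rnormZ.
  have -> : scalar_re (`|'i%C| : scalar_field R ComplexScalars) = 1.
    by rewrite normc_def /= expr0n /= add0r expr1n sqrtr1.
  by rewrite mul1r.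
Qed.

(** * Diametral points and the unit sphere *)

Section DD_points.
Context (R : realType) (s : scalar_kind) (Z : normedModType (scalar_field R s)).
Notation F := (scalar_field R s).
Notation dual := (topological_dual Z).
Notation sc := (scalar_of s).

Lemma dual_bounded (I : finType) (phi : I -> dual) :
  exists2 C : R, 0 < C & forall i x, rnorm (sval (phi i) x : F^o) <= C * rnorm x.
Proof.
have /choice[C CP] i : exists C : R,
    0 < C /\ forall x, rnorm (sval (phi i) x : F^o) <= C * rnorm x.
  by have [C C0 CP] := continuous_bounded (proj2_sig (phi i)); exists C.
exists (1 + \sum_i C i) => [|i x].
  by rewrite ltr_pwDl// sumr_ge0// => i _; exact: ltW (CP i).1.
apply: le_trans ((CP i).2 x) _; rewrite ler_wpM2r ?rnorm_ge0//.
rewrite (bigD1 i)//= addrCA lerDl addr_ge0// sumr_ge0// => j _.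
exact: ltW (CP j).1.
Qed.

(** Test points may leave the ball slightly: dividing them by [1 + e'] costs an
    amount controlled by a common bound of the functionals. *)
Lemma DD_point_of_approx (z : Z) : rnorm z <= 1 ->
  (forall (I : finType) (phi : I -> dual) (e : R), 0 < e ->
   exists u, [/\ rnorm u <= 1 + e, weak_nbhd phi e z u & 2 - e < rnorm (z - u)]) ->
  DD_point z.
Proof.
move=> z1 h; split => // I phi e e0.
have [C C0 phiC] := dual_bounded phi.
have C20 : 0 < 2 + C by rewrite addr_gt0.
pose e' := e / (2 + C).
have e'0 : 0 < e' by rewrite divr_gt0.
have e'E : e' * (2 + C) = e by rewrite divfK// gt_eqF.
have Ce'0 : 0 < C * e' by rewrite mulr_gt0.
have [u [u1 zu zue]] := h I phi e' e'0.
have e1 : 0 < 1 + e' by rewrite addr_gt0.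
pose y := sc (1 + e')^-1 *: u.
have yu : rnorm (y - u) <= e'.
  have -> : y - u = sc (- (e' / (1 + e'))) *: u.
    rewrite /y -[X in _ - X]scale1r -scalerBl -scalar_of1 -scalar_ofN -scalar_ofD.
    by congr (sc _ *: _); field; rewrite gt_eqF.
  rewrite rnormZ_of normrN gtr0_norm ?divr_gt0//.
  by rewrite mulrAC ler_pdivrMr// ler_pM2l.
exists y; split.
- rewrite /y rnormZ_of gtr0_norm ?invr_gt0//.
  by rewrite mulrC ler_pdivrMr// mul1r.
- move=> i; have -> : y - z = (y - u) + (u - z) by rewrite addrA subrK.
  rewrite linearD; apply: le_lt_trans (ler_rnormD _ _) _.
  have := zu i; have := phiC i (y - u).
  have : C * rnorm (y - u) <= C * e' by rewrite ler_pM2l.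
  by lra.
- have := ler_rnormD (z - y) (y - u); rewrite addrA subrK.
  by lra.
Qed.

(** A projection onto the common kernel, built one functional at a time: if the
    new functional does not vanish on the previous kernel, a vector [w1] of that
    kernel on which it is 1 serves to correct the projection. *)
Lemma common_kernel_projection (I : finType) (phi : I -> dual) (r : seq I) :
  uniq r -> exists u : I -> Z, forall x i, i \in r ->
    sval (phi i) (x - \sum_(j <- r) sval (phi j) x *: u j) = 0.
Proof.
elim: r => [|i0 r IH] /=; first by exists (fun=> 0).
move=> /andP[i0r /IH[u uP]]; pose p x := \sum_(j <- r) sval (phi j) x *: u j.
have [[w [wr wi0]]|nw] := pselect (exists w, (forall i, i \in r -> sval (phi i) w = 0) /\
    sval (phi i0) w != 0).
- pose w1 := (sval (phi i0) w)^-1 *: w.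
  have w1i0 : sval (phi i0) w1 = 1 by rewrite linearZ /= [LHS]mulVf.
  have w1r i : i \in r -> sval (phi i) w1 = 0.
    by move=> /wr wi; rewrite linearZ /= wi [LHS]mulr0.
  exists (fun i => if i == i0 then w1 else u i - sval (phi i0) (u i) *: w1).
  move=> x i.
  have -> : \sum_(j <- i0 :: r) sval (phi j) x *:
      (if j == i0 then w1 else u j - sval (phi i0) (u j) *: w1) =
      p x + sval (phi i0) (x - p x) *: w1.
    rewrite big_cons eqxx.
    rewrite (eq_big_seq (fun j => sval (phi j) x *: u j -
       (sval (phi j) x * sval (phi i0) (u j)) *: w1)); last first.
      move=> j jr; case: eqP => [ji0|_]; first by rewrite -ji0 jr in i0r.
      by rewrite scalerBr scalerA.
    rewrite sumrB -scaler_suml -/(p x) linearB scalerBl addrCA; congr (_ + (_ - _)).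
    congr (_ *: _); rewrite linear_sum; apply: eq_bigr => j _.
    by rewrite linearZ.
  rewrite inE opprD addrA linearB linearZ /=.
  move=> /orP[/eqP ->|ir].
    by rewrite w1i0 /GRing.scale /= mulr1 subrr.
  by rewrite (uP _ _ ir) w1r// /GRing.scale /= mulr0 subrr.
- exists (fun i => if i == i0 then 0 else u i) => x i.
  have -> : \sum_(j <- i0 :: r) sval (phi j) x *: (if j == i0 then 0 else u j) = p x.
    rewrite big_cons eqxx scaler0 add0r; apply: eq_big_seq => j jr.
    by case: eqP => // ji0; rewrite -ji0 jr in i0r.
  rewrite inE => /orP[/eqP ->|/uP//].
  apply: contrapT => /eqP ph0; apply: nw; exists (x - p x); split => //.
  by move=> j jr; exact: uP.
Qed.

(** With a trivial common kernel, [x = sum_j phi_j(x) u_j] would bound the norm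
    by the functionals, and weakly close points would be close in norm. *)
Lemma DD_point_common_kernel (z : Z) (I : finType) (phi : I -> dual) :
  DD_point z -> exists2 h : Z, h != 0 & forall i, sval (phi i) h = 0.
Proof.
move=> [_ zDD]; have [u uP] := common_kernel_projection phi (index_enum_uniq I).
apply: contrapT => nh.
have xE x : x = \sum_j sval (phi j) x *: u j.
  apply/eqP; rewrite -subr_eq0; apply/negP => /negP xn0; apply: nh.
  by exists (x - \sum_j sval (phi j) x *: u j) => // i; rewrite uP// mem_index_enum.
pose M := \sum_j rnorm (u j).
have M0 : 0 <= M by apply: sumr_ge0 => j _; exact: rnorm_ge0.
have M10 : 0 < M + 1 by rewrite ltr_wpDl.
have [|y [_ zy zye]] := zDD I phi (M + 1)^-1; first by rewrite invr_gt0.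
have : rnorm (z - y) <= (M + 1)^-1 * M.
  rewrite rnorm_distC {1}(xE (y - z)); apply: le_trans (rnorm_sum _ _ _) _.
  rewrite mulr_sumr; apply: ler_sum => j _; rewrite rnormZ.
  by rewrite ler_wpM2r ?rnorm_ge0// ltW// zy.
have E : (M + 1)^-1 * M = 1 - (M + 1)^-1 by field; rewrite gt_eqF.
have : (M + 1)^-1 <= 1 by rewrite invf_le1// lerDr.
by rewrite E; lra.
Qed.

Lemma line_meets_sphere (z0 h : Z) : rnorm z0 <= 1 -> h != 0 ->
  exists t : R, rnorm (z0 + sc t *: h) = 1.
Proof.
move=> z01 h0.
have nh0 : 0 < rnorm h.
  by rewrite lt_neqAle rnorm_ge0 andbT eq_sym; apply: contra_neq h0; exact: rnorm_eq0.
pose g (t : R) : R := rnorm (z0 + sc t *: h).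
have gc : continuous g.
  move=> t; apply/cvgrPdist_lt => e e0; near=> t'.
  apply: le_lt_trans (ler_dist_rnorm _ _) _.
  rewrite opprD addrACA subrr add0r -scalerBl -scalar_ofN -scalar_ofD rnormZ_of.
  rewrite -ltr_pdivlMr//.
  by near: t'; apply: cvgr_dist_lt => //; rewrite divr_gt0.
have T0 : 0 <= 2 / rnorm h by rewrite divr_ge0// rnorm_ge0.
have [||t _ gt] := @IVT R g 0 (2 / rnorm h) 1 T0.
- by apply: continuous_subspaceT.
- have g0 : g 0 <= 1 by rewrite /g scalar_of0 scale0r addr0.
  have gT : 1 <= g (2 / rnorm h).
    have := ler_rnormD (z0 + sc (2 / rnorm h) *: h) (- z0).
    rewrite addrAC subrr add0r rnormZ_of normrM normfV !gtr0_norm//.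
    by rewrite divfK ?gt_eqF// rnormN /g; lra.
  by rewrite ge_min le_max g0 gT orbT.
- by exists t.
Unshelve. all: by end_near. Qed.

(** Move from [z0] along a direction invisible to the functionals until the norm
    is one. *)
Lemma DD_point_nbhd_meets_sphere (z : Z) (I : finType) (phi : I -> dual) (z0 : Z) :
  DD_point z -> rnorm z0 <= 1 ->
  exists2 x, rnorm x = 1 & forall i, sval (phi i) (x - z0) = 0.
Proof.
move=> zDD z01; have [h h0 phih] := DD_point_common_kernel phi zDD.
have [t ht] := line_meets_sphere z01 h0.
exists (z0 + sc t *: h) => // i.
by rewrite addrAC subrr add0r linearZ /= phih [LHS]mulr0.
Qed.

(** Approximating the points of the sphere is enough: it yields one DD point, and
    then every weak neighbourhood of a point of the ball meets the sphere. *)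
Lemma weak_DD2P_of_sphere : (exists z : Z, z != 0) ->
  (forall (I : finType) (phi : I -> dual) (e : R) (z0 : Z), 0 < e -> rnorm z0 = 1 ->
    exists2 z, DD_point z & weak_nbhd phi e z0 z) ->
  weak_DD2P Z.
Proof.
move=> [z z0] h; apply/weak_DD2PE => I phi e x0 e0 x01.
have [t t1] : exists t : R, rnorm (0 + sc t *: z) = 1.
  by apply: line_meets_sphere => //; rewrite rnorm0.
have [z1 z1DD _] := h void (of_void _) 1 _ ltr01 t1.
have [x x1 phix] := DD_point_nbhd_meets_sphere phi z1DD x01.
have [y yDD xy] := h I phi e x e0 x1.
exists y => // i; have -> : y - x0 = (y - x) + (x - x0) by rewrite addrA subrK.
by rewrite linearD /= phix addr0; exact: xy.
Qed.

End DD_points.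

Section dual_comp.
Context (R : realType) (s : scalar_kind) (X Z : normedModType (scalar_field R s)).
Variables (f : {linear X -> Z}) (fc : continuous f) (phi : topological_dual Z).

Lemma dual_comp_continuous : continuous (sval phi \o f).
Proof.
move=> x; apply: continuous_comp; first exact: fc.
exact: (proj2_sig phi).
Qed.

Definition dual_comp : topological_dual X :=
  exist _ [the {linear X -> (scalar_field R s)^o} of sval phi \o f] dual_comp_continuous.

End dual_comp.

(** * Passing to L-summands and to l1-sums *)
Section L_summand.
Context (R : realType) (s : scalar_kind) (X Z : normedModType (scalar_field R s)).
Notation sc := (scalar_of s).
Variables (J : {linear X -> Z}) (P : {linear Z -> X}).
Hypothesis PJ : cancel J P.
Hypothesis normP : forall z, rnorm z = rnorm (P z) + rnorm (z - J (P z)).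

Let normJ x : rnorm (J x) = rnorm x.
Proof. by rewrite normP PJ subrr rnorm0 addr0. Qed.

Let Jc : continuous J.
Proof. by apply: (@bounded_continuous _ _ _ _ _ 1) => x; rewrite normJ mul1r. Qed.

Let Pc : continuous P.
Proof.
apply: (@bounded_continuous _ _ _ _ _ 1) => z.
by rewrite mul1r (normP z) lerDl rnorm_ge0.
Qed.

(** Let [z = J x + y] be a DD point near [J x0].  A functional norming [x0] gives
    [|y| < d], so [r = 1 - |y|] is close to one.  If [z2 = J x2 + y2] is weakly
    near [z] and far from it, a functional norming [z] norms both components and
    gives [|x2| >= |x| - q] and [|y2| >= |y| - 2 q]; with [|z2| <= 1] this forces
    [|x2| <= r + 2 q] and [|x - x2| >= 2 r - 3 q].  Dividing by [r] shows that
    [x / r] is a DD point. *)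
Lemma L_summand_DD_point : weak_DD2P Z ->
  forall (I : finType) (phi : I -> topological_dual X) (e : R) (x0 : X),
  0 < e -> rnorm x0 = 1 -> exists2 x, DD_point x & weak_nbhd phi e x0 x.
Proof.
move=> /weak_DD2PE ZDD I phi e x0 e0 x01.
have [f [f_le fx0]] := hahn_banach x0.
have [C C0 phiC] := dual_bounded phi.
have C10 : 0 < 1 + C by rewrite addr_gt0.
pose d := Num.min 2^-1 (e / (1 + C)).
have d0 : 0 < d by rewrite lt_min invr_gt0 ltr0n divr_gt0.
have d2 : d <= 2^-1 by rewrite ge_min lexx.
have dC : d * (1 + C) <= e by rewrite -ler_pdivlMr// ge_min lexx orbT.
have Jx01 : rnorm (J x0) <= 1 by rewrite normJ x01.
have [z [z1 zDD] zx0] := ZDD (option I) (fun o =>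
  dual_comp Pc (if o is Some i then phi i else f)) d (J x0) d0 Jx01.
pose x := P z; pose y := z - J x; pose r := 1 - rnorm y.
have Nz : rnorm z = rnorm x + rnorm y by exact: normP.
have xd : 1 - d < rnorm x.
  have := zx0 None; rewrite /= linearB PJ -/x => fd.
  have := le_lt_trans (normr_scalar_re _) fd.
  rewrite linearB scalar_reB fx0 x01 => /ltr_normlP[h _].
  by have := f_le x; lra.
have y0 := rnorm_ge0 y.
have r0 : 0 < r by rewrite /r; lra.
have ri0 : 0 < r^-1 by rewrite invr_gt0.
have ri2 : r^-1 <= 2 by rewrite -[2]invrK lef_pV2 ?posrE ?invr_gt0// /r; lra.
have xr : rnorm x <= r by rewrite /r; lra.
pose xh := sc r^-1 *: x.
have xhB (v : X) : xh - sc r^-1 *: v = sc r^-1 *: (x - v) by rewrite -scalerBr.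
exists xh; last first.
  move=> i; have -> : xh - x0 = (xh - x) + (x - x0) by rewrite addrA subrK.
  rewrite linearD; apply: le_lt_trans (ler_rnormD _ _) _.
  have := zx0 (Some i); rewrite /= linearB PJ -/x => h1.
  have h2 : rnorm (xh - x) <= rnorm y.
    have -> : xh - x = sc (r^-1 - 1) *: x.
      by rewrite /xh scalar_ofD scalar_ofN scalar_of1 scalerBl scale1r.
    rewrite rnormZ_of ger0_norm; last first.
      by rewrite subr_ge0 -[X in X <= _]invr1 lef_pV2 ?posrE// /r; lra.
    apply: (@le_trans _ _ ((r^-1 - 1) * r)).
      by rewrite ler_wpM2l// subr_ge0 -[X in X <= _]invr1 lef_pV2 ?posrE// /r; lra.
    by rewrite mulrBl mulVf ?gt_eqF// mul1r /r; lra.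
  have h3 := phiC i (xh - x).
  have h4 : C * rnorm (xh - x) <= C * d.
    by apply: ler_wpM2l; [exact: ltW|apply: le_trans h2 _; lra].
  by lra.
apply: DD_point_of_approx => [|I' psi e' e'0].
  rewrite rnormZ_of gtr0_norm// -(@mulVf _ r) ?gt_eqF//.
  by rewrite ler_pM2l.
have [h [h_le hz]] := hahn_banach z.
pose q := e' / 6.
have q0 : 0 < q by rewrite divr_gt0.
have qE : q = e' / 6 by [].
(* [h] and [h \o J \o P] together control [h] on both components *)
have [z2 [z21 zz2 z2e]] := zDD (option (option I')) (fun o => match o with
  | Some (Some j) => dual_comp Pc (psi j)
  | Some None => dual_comp Pc (dual_comp Jc h)
  | None => h end) q q0.
pose x2 := P z2; pose y2 := z2 - J x2.
have Nz2 : rnorm z2 = rnorm x2 + rnorm y2 by exact: normP.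
have Nzz2 : rnorm (z - z2) = rnorm (x - x2) + rnorm (y - y2).
  rewrite normP (linearB P) (linearB J); congr (_ + rnorm _).
  by rewrite /y /y2 !opprD [RHS]addrACA.
have hxx2 := zz2 (Some None); rewrite /= linearB -/x -/x2 linearB linearB in hxx2.
have {}hxx2 := le_lt_trans (normr_scalar_re _) hxx2.
have hzz2 := zz2 None; rewrite /= linearB in hzz2.
have {}hzz2 := le_lt_trans (normr_scalar_re _) hzz2.
move: hxx2 hzz2; rewrite !scalar_reB => /ltr_normlP[a1 a2] /ltr_normlP[b1 b2].
have := h_le (J x); have := h_le (J x2); have := h_le y; have := h_le y2.
rewrite /y /y2 !linearB !scalar_reB -/y -/y2 !normJ => c1 c2 c3 c4.
have x0' := rnorm_ge0 x; have y20 := rnorm_ge0 y2.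
have n1 := ler_rnormD z (- z2); rewrite rnormN in n1.
have n2 := ler_rnormD y (- y2); rewrite rnormN in n2.
have x2r : rnorm x2 <= r + 2 * q by rewrite /r; lra.
have xx2 : 2 * r - 3 * q < rnorm (x - x2) by rewrite /r; lra.
exists (sc r^-1 *: x2); split.
- rewrite rnormZ_of gtr0_norm//; apply: (@le_trans _ _ (r^-1 * (r + 2 * q))).
    by rewrite ler_pM2l.
  rewrite mulrDr mulVf ?gt_eqF//; have : r^-1 * (2 * q) <= 2 * (2 * q).
    by rewrite ler_wpM2r// mulr_ge0// ltW.
  by lra.
- move=> j; rewrite -rnormN -linearN opprB xhB linearZ.
  have := zz2 (Some (Some j)); rewrite /= linearB -/x -/x2 => pj.
  rewrite -opprB linearN scalerN rnormN.
  have -> : rnorm (sc r^-1 *: sval (psi j) (x2 - x)) =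
    r^-1 * rnorm (sval (psi j) (x2 - x)) by rewrite rnormZ_of gtr0_norm.
  have : r^-1 * rnorm (sval (psi j) (x2 - x)) <= 2 * rnorm (sval (psi j) (x2 - x)).
    by rewrite ler_wpM2r// rnorm_ge0.
  by lra.
- rewrite xhB rnormZ_of gtr0_norm//.
  have : r^-1 * (2 * r - 3 * q) < r^-1 * rnorm (x - x2) by rewrite ltr_pM2l.
  have : r^-1 * (3 * q) <= 2 * (3 * q) by rewrite ler_wpM2r// mulr_ge0// ltW.
  have -> : r^-1 * (2 * r - 3 * q) = 2 - r^-1 * (3 * q) by field; rewrite gt_eqF.
  by lra.
Qed.

Lemma L_summand_weak_DD2P : (exists x : X, x != 0) -> weak_DD2P Z -> weak_DD2P X.
Proof. by move=> X0 /L_summand_DD_point; exact: weak_DD2P_of_sphere. Qed.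

End L_summand.

Section l1_approximation.
Context (R : realType) (s : scalar_kind) (X Z : normedModType (scalar_field R s)).
Notation sc := (scalar_of s).

(** The maps [iota j] embed copies of [X] so that the span is a weighted l1-sum;
    the weights are measures of sets and some of them may vanish. *)
Record l1_embedding (J : finType) (alpha : J -> R) (iota : J -> {linear X -> Z}) : Prop := {
  l1_ge0 : forall j, 0 <= alpha j ;
  l1_gt0 : 0 < \sum_j alpha j ;
  l1_norm : forall y : J -> X,
    rnorm (\sum_j iota j (y j)) = \sum_j alpha j * rnorm (y j) }.

Lemma l1_embedding_continuous J alpha iota j :
  @l1_embedding J alpha iota -> continuous (iota j).
Proof.
move=> l1; apply: (@bounded_continuous _ _ _ _ _ (alpha j)) => x.
have := l1_norm l1 (fun i => if i == j then x else 0).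
rewrite (bigD1 j)//= eqxx big1 => [|i /negPf ->]; last by rewrite linear0.
rewrite addr0 (bigD1 j)//= eqxx big1 => [|i /negPf ->].
  by rewrite addr0 => ->.
by rewrite rnorm0 mulr0.
Qed.

(** Given [z1 = sum_j iota_j(a_j)] in the ball, the weights
    [b_j = |a_j| + c], with [c] such that [sum_j alpha_j b_j = 1], turn [z1] into
    the image under [lift] of the vectors [a_j / b_j] of the ball of [X].  These
    are moved to DD points [w_j]; distances from [lift w] are averages, with
    weights [alpha_j b_j], of distances from the [w_j]. *)
Lemma weak_DD2P_of_l1_approx : weak_DD2P X ->
  (forall (z : Z) (e : R), rnorm z <= 1 -> 0 < e ->
     exists (J : finType) (alpha : J -> R) (iota : J -> {linear X -> Z}) (a : J -> X),
     [/\ l1_embedding alpha iota, rnorm (\sum_j iota j (a j)) <= 1 &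
         rnorm (z - \sum_j iota j (a j)) < e]) ->
  weak_DD2P Z.
Proof.
move=> /weak_DD2PE XDD happ; apply/weak_DD2PE => I phi e z0 e0 z01.
have [C C0 phiC] := dual_bounded phi.
have [J [alpha [iota [a [l1 a1 az0]]]]] : exists (J : finType) (alpha : J -> R)
     (iota : J -> {linear X -> Z}) (a : J -> X),
     [/\ l1_embedding alpha iota, rnorm (\sum_j iota j (a j)) <= 1 &
         rnorm (z0 - \sum_j iota j (a j)) < e / 2 / C].
  by apply: happ => //; rewrite !divr_gt0.
have iotac j : continuous (iota j) by exact: l1_embedding_continuous l1.
have alpha0 := l1_ge0 l1; have salpha0 := l1_gt0 l1.
pose c := (1 - \sum_j alpha j * rnorm (a j)) / \sum_j alpha j.
have c0 : 0 <= c by rewrite divr_ge0 ?(ltW salpha0)// subr_ge0 -(l1_norm l1).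
pose b j := rnorm (a j) + c.
have b0 j : 0 <= b j by rewrite addr_ge0 ?rnorm_ge0.
have alphab : \sum_j alpha j * b j = 1.
  under eq_bigr do rewrite mulrDr.
  rewrite big_split/= -mulr_suml [X in _ + X]mulrC /c divfK ?gt_eqF//.
  by rewrite addrC subrK.
pose x j := sc (b j)^-1 *: a j.
have ab j : rnorm (a j) <= b j by rewrite lerDl.
have x1 j : rnorm (x j) <= 1.
  rewrite rnormZ_of ger0_norm ?invr_ge0//.
  have [->|bj0] := eqVneq (b j) 0; first by rewrite invr0 mul0r.
  by rewrite mulrC ler_pdivrMr ?mul1r// lt_neqAle eq_sym bj0 b0.
have aE j : a j = sc (b j) *: x j.
  have [bj0|bj0] := eqVneq (b j) 0; last first.
    by rewrite scalerA -scalar_ofM mulfV// scalar_of1 scale1r.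
  rewrite bj0 scalar_of0 scale0r; apply: rnorm_eq0; apply/eqP.
  by rewrite eq_le rnorm_ge0 andbT -bj0.
pose B := 1 + \sum_j b j.
have B0 : 0 < B by rewrite ltr_wpDr// sumr_ge0.
have e2B : 0 < e / 2 / B by rewrite !divr_gt0.
have /choice[w wP] j : exists w, DD_point w /\
    weak_nbhd (fun i => dual_comp (iotac j) (phi i)) (e / 2 / B) (x j) w.
  by have [w ? ?] := XDD I (fun i => dual_comp (iotac j) (phi i)) _ _ e2B (x1 j); exists w.
pose lift (v : J -> X) := \sum_j iota j (sc (b j) *: v j).
have norm_lift v : rnorm (lift v) = \sum_j alpha j * b j * rnorm (v j).
  rewrite /lift (l1_norm l1); apply: eq_bigr => j _.
  by rewrite rnormZ_of ger0_norm// mulrA.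
have liftB v v' : lift v - lift v' = lift (fun j => v j - v' j).
  rewrite -sumrB; apply: eq_bigr => j _.
  by rewrite -linearB -scalerBr.
have lift_near (K : finType) (psi : K -> topological_dual Z) (t : R) v v' :
    0 < t -> (forall j, weak_nbhd (fun i => dual_comp (iotac j) (psi i)) (t / B) (v' j) (v j)) ->
    weak_nbhd psi t (lift v') (lift v).
  move=> t0 vv' k; rewrite liftB linear_sum.
  apply: le_lt_trans (rnorm_sum _ _ _) _.
  apply: (@le_lt_trans _ _ (\sum_j b j * (t / B))).
    apply: ler_sum => j _; rewrite !linearZ rnormZ_of ger0_norm//.
    by rewrite ler_wpM2l//; apply: ltW; exact: vv'.
  rewrite -mulr_suml mulrA ltr_pdivrMr// mulrC ltr_pM2l//.
  by rewrite /B ltrDr.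
have lift_ball v : (forall j, rnorm (v j) <= 1) -> rnorm (lift v) <= 1.
  move=> v1; rewrite norm_lift -[X in _ <= X]alphab; apply: ler_sum => j _.
  by rewrite ler_piMr// mulr_ge0.
have lift_x : lift x = \sum_j iota j (a j).
  by apply: eq_bigr => j _; rewrite -aE.
exists (lift w); last first.
  move=> i; have -> : lift w - z0 = (lift w - lift x) + (lift x - z0).
    by rewrite addrA subrK.
  rewrite linearD; apply: le_lt_trans (ler_rnormD _ _) _.
  have h1 : rnorm (sval (phi i) (lift w - lift x)) < e / 2.
    by apply: (lift_near _ phi); [rewrite divr_gt0|move=> j; exact: (wP j).2].
  have h2 : rnorm (sval (phi i) (lift x - z0)) < e / 2.
    apply: le_lt_trans (phiC _ _) _; rewrite mulrC -ltr_pdivlMr//.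
    by rewrite rnorm_distC lift_x.
  by rewrite [e]splitr; exact: ltrD.
split; first by apply: lift_ball => j; have [[]] := wP j.
move=> K psi e' e'0.
pose e1 := Num.min (e' / 2) (e' / B).
have e10 : 0 < e1 by rewrite lt_min !divr_gt0.
have /choice[y yP] j : exists y, [/\ rnorm y <= 1,
    weak_nbhd (fun i => dual_comp (iotac j) (psi i)) e1 (w j) y &
    2 - e1 < rnorm (w j - y)].
  by have [_ h] := (wP j).1; exact: h.
exists (lift y); split.
- by apply: lift_ball => j; have [] := yP j.
- apply: lift_near => // j i; have [_ h _] := yP j.
  by apply: lt_le_trans (h i) _; rewrite ge_min lexx orbT.
- apply: (@lt_le_trans _ _ (2 - e1)).
    rewrite ltrD2l ltrN2; apply: (@le_lt_trans _ _ (e' / 2)); last by lra.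
    by rewrite ge_min lexx.
  have -> : 2 - e1 = \sum_j alpha j * b j * (2 - e1).
    by rewrite -mulr_suml alphab mul1r.
  rewrite liftB norm_lift; apply: ler_sum => j _.
  by rewrite ler_wpM2l ?mulr_ge0//; have [_ _ /ltW] := yP j.
Qed.

End l1_approximation.

(** * Averages approximating convex combinations *)

Section greedy_sum.
Context (R : realType) (J K : finType).
Variables (lam : J -> R) (w : J -> K -> R) (C : R).
Hypothesis lam_ge0 : forall j, 0 <= lam j.
Hypothesis lam_gt0 : 0 < \sum_j lam j.
Hypothesis lam_w : forall k, \sum_j lam j * w j k = 0.
Hypothesis w_le : forall j k, 0 < lam j -> `|w j k| <= C.

(** The [w j] average to zero, hence so do their inner products with [S]. *)
Lemma exists_obtuse (S : K -> R) :
  exists2 j, 0 < lam j & \sum_k S k * w j k <= 0.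
Proof.
apply: contrapT => nj.
have npos j : 0 < lam j -> 0 < \sum_k S k * w j k.
  by move=> lj; rewrite ltNge; apply/negP => h; apply: nj; exists j.
have sum0 : \sum_j lam j * \sum_k S k * w j k = 0.
  under eq_bigr do rewrite mulr_sumr.
  rewrite exchange_big /=; apply: big1 => k _.
  under eq_bigr do rewrite mulrCA.
  by rewrite -mulr_sumr lam_w mulr0.
have pos j : true -> 0 <= lam j * \sum_k S k * w j k.
  have := lam_ge0 j; rewrite le_eqVlt => /orP[/eqP <-|lj]; first by rewrite mul0r.
  by rewrite mulr_ge0 ?ltW// npos.
have lam0 j : lam j = 0.
  apply/eqP; apply: contraT => lj0.
  have lj : 0 < lam j by rewrite lt_neqAle eq_sym lj0 lam_ge0.
  have /eqP : lam j * \sum_k S k * w j k = 0 by exact: (psumr_eq0P pos sum0).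
  by rewrite mulf_eq0 (negPf lj0) gt_eqF// npos.
by move: lam_gt0; rewrite big1 ?ltxx.
Qed.

(** Adding at each step a vector at an obtuse angle with the current sum makes
    the squared length grow by at most the squared length of that vector. *)
Lemma greedy_sum_small (m : nat) : exists l : seq J,
  [/\ size l = m, {in l, forall j, 0 < lam j} &
      \sum_k (\sum_(j <- l) w j k) ^+ 2 <= m%:R * (#|K|%:R * C ^+ 2)].
Proof.
elim: m => [|m [l [lm l0 lC]]].
  exists [::]; split => //; rewrite mul0r.
  by rewrite big1// => k _; rewrite big_nil expr0n.
have [j lj Sj] := exists_obtuse (fun k => \sum_(j <- l) w j k).
exists (j :: l); split => [|i|]; first by rewrite /= lm.
  by rewrite inE => /orP[/eqP ->//|/l0].
rewrite (eq_bigr (fun k => w j k ^+ 2 + 2 * ((\sum_(j <- l) w j k) * w j k) +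
    (\sum_(j <- l) w j k) ^+ 2)); last first.
  by move=> k _; rewrite big_cons; ring.
rewrite !big_split /= -mulr_sumr.
rewrite -[m.+1%:R]natr1 mulrDl mul1r.
have : \sum_k w j k ^+ 2 <= #|K|%:R * C ^+ 2.
  rewrite mulr_natl -sumr_const; apply: ler_sum => k _.
  by rewrite -[leLHS]real_normK ?num_real// lerXn2r ?nnegrE ?w_le// (le_trans _ (w_le k lj)).
by move: Sj lC; lra.
Qed.

End greedy_sum.

Section empirical_approximation.
Context (R : realType) (s : scalar_kind) (Z : normedModType (scalar_field R s)).
Notation sc := (scalar_of s).

(** A dimension-free version of Caratheodory's theorem in the manner of Maurey:
    the number [m] of vectors depends on the functionals and the tolerance but
    not on the convex combination.  The greedy choice is applied to the real and
    imaginary parts of the functionals at the deviations [u j - f]. *)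
Lemma empirical_approximation (I : finType) (phi : I -> topological_dual Z) (e : R) :
  0 < e -> exists2 m : nat, (0 < m)%N &
  forall (J : finType) (lam : J -> R) (u : J -> Z),
    (forall j, 0 <= lam j) -> \sum_j lam j = 1 ->
    (forall j, 0 < lam j -> rnorm (u j) <= 1) ->
    rnorm (\sum_j sc (lam j) *: u j) <= 1 ->
    exists l : seq J, [/\ size l = m, {in l, forall j, 0 < lam j} &
      weak_nbhd phi e (\sum_j sc (lam j) *: u j) (sc m%:R^-1 *: \sum_(j <- l) u j)].
Proof.
move=> e0; have [C C0 phiC] := dual_bounded phi.
pose K : finType := (I * bool)%type; pose B := #|K|%:R * (2 * C) ^+ 2.
have B0 : 0 <= B by rewrite mulr_ge0// sqr_ge0.
pose m := (Num.truncn (B / (e / 2) ^+ 2)).+1.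
(* a sum of squares at most [m * B], divided by [m ^ 2], is below [(e / 2) ^ 2] *)
have mB : B < m%:R * (e / 2) ^+ 2.
  by rewrite -ltr_pdivrMr ?exprn_gt0 ?divr_gt0// truncnS_gt.
exists m => // J lam u lam0 lam1 u1 f1.
set f := \sum_j _.
pose part (b : bool) (a : (scalar_field R s)^o) : R := if b then scalar_re a else scalar_im a.
have partD b x y : part b (x + y) = part b x + part b y.
  by case: b; [exact: scalar_reD|exact: scalar_imD].
have partM b (c : R) x : part b (sc c *: x) = c * part b x.
  by case: b; [exact: scalar_reM|exact: scalar_imM].
have part0 b : part b 0 = 0.
  by apply: (@addrI _ (part b 0)); rewrite -partD !addr0.
have part_sum b (T : Type) (r : seq T) (g : T -> (scalar_field R s)^o) :
    part b (\sum_(t <- r) g t) = \sum_(t <- r) part b (g t).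
  exact: (big_morph _ (partD b) (part0 b)).
have part_norm b x : `|part b x| <= rnorm (x : (scalar_field R s)^o).
  by case: b; [exact: normr_scalar_re|exact: normr_scalar_im].
pose w j (k : K) := part k.2 (sval (phi k.1) (u j - f)).
have sum0 k : \sum_j lam j * w j k = 0.
  under eq_bigr do rewrite -partM.
  rewrite -part_sum.
  have -> : \sum_j sc (lam j) *: sval (phi k.1) (u j - f) =
      sval (phi k.1) (\sum_j sc (lam j) *: (u j - f)).
    by rewrite (linear_sum (sval (phi k.1))); apply: eq_bigr => j _; rewrite linearZ.
  under eq_bigr do rewrite scalerBr.
  rewrite sumrB -scaler_suml -/f.
  rewrite -(big_morph sc (@scalar_ofD R s) (scalar_of0 R s)) lam1.
  by rewrite scalar_of1 scale1r subrr linear0 part0.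
have wC j k : 0 < lam j -> `|w j k| <= 2 * C.
  move=> lj; apply: le_trans (part_norm _ _) _; apply: le_trans (phiC _ _) _.
  rewrite mulrC ler_pM2r//; apply: le_trans (ler_rnormD _ _) _.
  by rewrite rnormN; have := u1 j lj; lra.
have lamp : 0 < \sum_j lam j by rewrite lam1.
have [l [lm l0 lB]] := greedy_sum_small lam0 lamp sum0 wC m.
exists l; split => // i.
have m0 : 0 < m%:R :> R by rewrite ltr0n.
have E : sc m%:R^-1 *: (\sum_(j <- l) u j) - f =
    sc m%:R^-1 *: \sum_(j <- l) (u j - f).
  rewrite sumrB big_const_seq count_predT lm iter_addr addr0 scalerBr; congr (_ - _).
  rewrite -(scaler_nat m f) -scalar_of_nat scalerA -scalar_ofM mulVf ?gt_eqF//.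
  by rewrite scalar_of1 scale1r.
have part_lt b : `|part b (sval (phi i) (sc m%:R^-1 *: (\sum_(j <- l) u j) - f))| < e / 2.
  rewrite E linearZ partM (linear_sum (sval (phi i))) part_sum.
  rewrite normrM normfV (gtr0_norm m0) mulrC ltr_pdivrMr//.
  rewrite -ltr_sqr ?nnegrE// ?mulr_ge0 ?divr_ge0 ?ltW//.
  rewrite real_normK ?num_real//.
  have -> : (e / 2 * m%:R) ^+ 2 = m%:R * (m%:R * (e / 2) ^+ 2) by ring.
  apply: le_lt_trans (_ : _ <= m%:R * B) _; last by rewrite ltr_pM2l.
  apply: le_trans lB; rewrite (bigD1 (i, b))//= lerDl.
  by apply: sumr_ge0 => k _; exact: sqr_ge0.
apply: le_lt_trans (rnorm_scalar_le _) _.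
by rewrite [e]splitr; apply: ltrD; [exact: (part_lt true)|exact: (part_lt false)].
Qed.

End empirical_approximation.

(** * Partitions of atomless finite measures *)

Section atomless_partition.
Context d (T : measurableType d) (R : realType) (nu : {measure set T -> \bar R}).
Hypothesis nu_fin : (nu setT < +oo)%E.
Hypothesis nu_atomless : atomless nu.

Let v (A : set T) : R := fine (nu A).

Let vK A : measurable A -> (v A)%:E = nu A.
Proof.
move=> mA; rewrite fineK// ge0_fin_numE//.
by apply: le_lt_trans nu_fin; apply: le_measure; rewrite ?inE.
Qed.

Let v_ge0 A : 0 <= v A.
Proof. exact: fine_ge0. Qed.

Let v_split A B : measurable A -> measurable B -> B `<=` A ->
  v A = v B + v (A `\` B).
Proof.
move=> mA mB BA; apply: EFin_inj; rewrite EFinD !vK//; last exact: measurableD.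
by rewrite (measureDI nu mA mB) setIidr// addeC.
Qed.

(** Of the two parts of a non-trivial splitting, the smaller one. *)
Let halve A : measurable A -> 0 < v A ->
  exists B, [/\ measurable B, B `<=` A, 0 < v B & v B <= v A / 2].
Proof.
move=> mA A0; have nA : ~ atom nu A by exact: nu_atomless.
have [B [mB BA B0 AB0]] : exists B, [/\ measurable B, B `<=` A, 0 < v B & 0 < v (A `\` B)].
  apply: contrapT => nB; apply: nA; split => //.
    by rewrite -vK// lte_fin.
  move=> B mB BA; apply: contrapT => /not_orP[B0 AB0]; apply: nB; exists B.
  have mAB : measurable (A `\` B) by exact: measurableD.
  split => //; rewrite lt_neqAle v_ge0 andbT eq_sym.
    by apply/eqP => vB; apply: B0; rewrite -(vK mB) vB.
  by apply/eqP => vB; apply: AB0; rewrite -(vK mAB) vB.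
have AE := v_split mA mB BA.
have [h|h] := leP (v B) (v A / 2); first by exists B.
exists (A `\` B); split => //; first exact: measurableD.
by move: AE h; lra.
Qed.

Let small_subset A (e : R) : measurable A -> 0 < v A -> 0 < e ->
  exists B, [/\ measurable B, B `<=` A, 0 < v B & v B <= e].
Proof.
move=> mA A0 e0.
have shrink n : exists B, [/\ measurable B, B `<=` A, 0 < v B & v B <= v A / (2 ^+ n)].
  elim: n => [|n [B [mB BA B0 Bn]]]; first by exists A; rewrite expr0 divr1; split.
  have [C [mC CB C0 Ch]] := halve mB B0.
  exists C; split => //; first exact: subset_trans BA.
  by apply: le_trans Ch _; rewrite exprSr invfM mulrA ler_pM2r ?invr_gt0.
pose n := Num.truncn (v A / e).
have [B [mB BA B0 Bn]] := shrink n.+1; exists B; split => //.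
apply: le_trans Bn _; rewrite ler_pdivrMr ?exprn_gt0// mulrC -ler_pdivrMr//.
apply: le_trans (ltW (truncnS_gt _)) _.
by rewrite -natrX ler_nat ltnW// ltn_expl.
Qed.

Let greedy_choice (e : R) (E : set T) : 0 < e -> measurable E ->
  exists B, [/\ measurable B, B `<=` E, v B <= e &
    forall C, measurable C -> C `<=` E -> v C <= e -> v C <= 2 * v B].
Proof.
move=> e0 mE; pose S := [set v C | C in [set C | [/\ measurable C, C `<=` E & v C <= e]]].
have v0 : v set0 = 0 by rewrite /v measure0.
have hS : has_sup S.
  split; first by exists (v set0), set0 => //; split => //; rewrite v0 ltW.
  by exists e => _ [C [_ _ Ce] <-].
have S_le C : measurable C -> C `<=` E -> v C <= e -> v C <= sup S.
  by move=> mC CE Ce; apply: ub_le_sup; [case: hS|exists C].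
have [S0|S0] := leP (sup S) 0.
  exists set0; split => //; first by rewrite v0 ltW.
  by move=> C mC CE Ce; rewrite v0 mulr0; exact: le_trans (S_le _ mC CE Ce) S0.
have S20 : 0 < sup S / 2 by rewrite divr_gt0.
have [_ [B [mB BE Be] <-] BS] := sup_adherent S20 hS.
exists B; split => // C mC CE Ce; have := S_le _ mC CE Ce.
by move: BS; lra.
Qed.

(** Remove again and again a piece of mass at most [e] that is at least half as
    large as possible.  If the rest never dropped to mass [e], the intersection
    of the rests would have mass at least [e] and contain a set [C] with
    [0 < nu C <= e]; each removed piece would then weigh at least [nu C / 2],
    which exhausts the finite total mass. *)
Lemma atomless_partition (e : R) : 0 < e ->
  exists (J : finType) (A : J -> set T),
    [/\ forall j, measurable (A j), forall j, (nu (A j) <= e%:E)%E &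
        forall t, \sum_j \1_(A j) t = 1 :> R].
Proof.
move=> e0.
have /choice[g gP] E : exists B, measurable E -> [/\ measurable B, B `<=` E, v B <= e &
    forall C, measurable C -> C `<=` E -> v C <= e -> v C <= 2 * v B].
  have [mE|nE] := pselect (measurable E); last by exists E.
  by have [B BP] := greedy_choice e0 mE; exists B.
pose E := fix E n := if n is m.+1 then E m `\` g (E m) else [set: T].
have mE n : measurable (E n).
  elim: n => [|n IH] /=; first exact: measurableT.
  by apply: measurableD => //; have [] := gP _ IH.
have [n En] : exists n, v (E n) <= e.
  apply: contrapT => nE.
  have Ee n : e < v (E n) by rewrite ltNge; apply/negP => h; apply: nE; exists n.
  have mEoo : measurable (\bigcap_n E n) by exact: bigcapT_measurable.
  have E_dec : {homo E : n m / (n <= m)%N >-> (m <= n)%O}.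
    apply: (homo_leq (r := fun A B => (B <= A)%O)).
    - by [].
    - by move=> A B C BA CB; exact: le_trans BA.
    - by move=> n; rewrite subsetEset; exact: subDsetl.
  have Eoo : e <= v (\bigcap_n E n).
    have cv := nonincreasing_cvg_mu (mu := nu) nu_fin mE mEoo E_dec.
    rewrite -lee_fin vK//; rewrite -(cvg_lim _ cv)//.
    apply: lime_ge; first by apply/cvg_ex; eexists; exact: cv.
    by apply: nearW => n /=; rewrite -vK// lee_fin ltW.
  have [C [mC CE C0 Ce]] := small_subset mEoo (lt_le_trans e0 Eoo) e0.
  have dec n : v (E n) <= v setT - n%:R * (v C / 2).
    elim: n => [|n IH]; first by rewrite mul0r subr0.
    have [mg gE ge gmax] := gP _ (mE n).
    have := gmax C mC (subset_trans CE (bigcap_inf I)) Ce.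
    have : v (E n) = v (g (E n)) + v (E n.+1) := v_split (mE n) mg gE.
    by rewrite -[n.+1%:R]natr1 mulrDl mul1r; lra.
  have := dec (Num.truncn (v setT / (v C / 2))).+1.
  have : v setT < (Num.truncn (v setT / (v C / 2))).+1%:R * (v C / 2).
    by rewrite -ltr_pdivrMr ?divr_gt0// truncnS_gt.
  by have := v_ge0 (E (Num.truncn (v setT / (v C / 2))).+1); lra.
pose A (j : 'I_n.+1) := if (j < n)%N then g (E j) else E n.
have mA j : measurable (A j).
  by rewrite /A; case: ifP => _ //; have [] := gP _ (mE j).
exists 'I_n.+1, A; split => //.
  move=> j; rewrite -vK// lee_fin /A; case: ifP => _ //.
  by have [] := gP _ (mE j).
move=> t; rewrite big_ord_recr /= {2}/A ltnn.
under eq_bigr do rewrite /A /= ltn_ord.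
elim: n {En A mA} => [|n IH].
  by rewrite big_ord0 add0r /= indicT.
rewrite big_ord_recr /= -addrA -[RHS]IH; congr (_ + _).
have [_ gE _ _] := gP _ (mE n).
rewrite !indicE in_setD; have [tg|tg] := boolP (t \in g (E n)).
  by rewrite andbF addr0 (mem_set (gE _ (set_mem tg))).
by rewrite andbT add0r.
Qed.

End atomless_partition.

(** * Integrable functions and their classes *)

Section weighted_integral.
Context d (T : measurableType d) (R : realType) (mu : {measure set T -> \bar R}).

Lemma integral_weighted (J : Type) (l : seq J) (A : J -> set T) (c : J -> R) (w : T -> R) :
  (forall j, measurable (A j)) -> (forall j, 0 <= c j) ->
  (forall t, 0 <= w t) -> measurable_fun setT (fun t => (w t)%:E) ->
  (\int[mu]_t ((\sum_(j <- l) c j * \1_(A j) t) * w t)%:E =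
   \sum_(j <- l) ((c j)%:E * \int[mu]_(t in A j) (w t)%:E))%E.
Proof.
move=> mA c0 w0 mw.
have mi j : measurable_fun setT (fun t => (w t)%:E * (\1_(A j) t)%:E)%E.
  apply: emeasurable_funM => //.
  by apply/measurable_EFinP; exact: measurable_indic.
under eq_integral => t _.
  rewrite mulr_suml -sumEFin.
  under eq_bigr => j _ do rewrite -mulrA [_ * w t]mulrC !EFinM.
  over.
rewrite ge0_integral_sum//.
- apply: eq_bigr => j _; rewrite ge0_integralZl//.
  + by rewrite [in RHS]integral_mkcond epatch_indic.
  + by move=> t _; rewrite -EFinM lee_fin mulr_ge0.
  + by rewrite lee_fin.
- by move=> j; apply: emeasurable_funM => //; exact: measurable_cst.
- by move=> j t _; rewrite -!EFinM lee_fin !mulr_ge0.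
Qed.

End weighted_integral.

Section L1_facts.
Context d (T : measurableType d) (R : realType) (mu : {measure set T -> \bar R}).
Variable cmu : measure_is_complete mu.
Context (s : scalar_kind) (X : normedModType (scalar_field R s)).
Notation bochner := (bochner_fun cmu X).
Notation L1 := (L1 cmu X).
Local Open Scope quotient_scope.

Lemma pi_L1_linear (a : scalar_field R s) (f g : bochner) :
  \pi_L1 (a *: f + g) = a *: \pi_L1 f + \pi_L1 g :> L1.
Proof.
have -> : a *: \pi_L1 f = \pi_L1 (a *: f) :> L1 by rewrite /GRing.scale /= !piE.
exact: raddfD.
Qed.

(** A plain function for the projection, to which a linear structure attaches. *)
Definition class_of : bochner -> L1 := \pi_L1.

HB.instance Definition _ :=
  GRing.isLinear.Build (scalar_field R s) bochner L1 _ class_of pi_L1_linear.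

Lemma class_of_repr (z : L1) : class_of (repr z) = z.
Proof. exact: reprK. Qed.

Lemma rnorm_class (f : bochner) :
  (rnorm (class_of f))%:E = (\int[mu]_t (rnorm (val f t))%:E)%E.
Proof. exact: rnorm_L1. Qed.

Lemma rnorm_bochner_measurable (f : bochner) :
  measurable_fun setT (fun t => (rnorm (val f t))%:E).
Proof. exact: (strongly_measurable_rnorm cmu (bochner_funP f).1). Qed.

Lemma bochner_val_sum (J : Type) (l : seq J) (f : J -> bochner) t :
  val (\sum_(j <- l) f j) t = \sum_(j <- l) val (f j) t.
Proof.
elim: l => [|j l IH]; first by rewrite !big_nil.
by rewrite !big_cons -IH.
Qed.

Lemma simple_bochner (f : T -> X) : mu_simple mu f -> bochner_integrable mu f.
Proof.
move=> sf; split; first exact: strongly_measurable_simple.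
exists (fun=> f); split => //.
under eq_fun do under eq_integral do rewrite subrr rnorm0.
by under eq_fun do rewrite integral0; exact: cvg_cst.
Qed.

Lemma bochner_of (f : T -> X) : bochner_integrable mu f ->
  exists g : bochner, val g = f.
Proof.
move=> bf; have fb : f \in (bochner_pred cmu : {pred T -> X}) by rewrite inE.
by exists (BochnerFun fb).
Qed.

Lemma measurable_restrict_preimage (A : set T) (f : T -> X) (x : X) :
  measurable A -> measurable (f @^-1` [set x]) ->
  measurable ((fun t => if t \in A then f t else 0) @^-1` [set x]).
Proof.
move=> mA mf; rewrite (_ : _ @^-1` _ = (A `&` f @^-1` [set x]) `|`
    (~` A `&` (fun=> 0) @^-1` [set x])).
  apply: measurableU; apply: measurableI => //; first exact: measurableC.
  by rewrite preimage_cst; case: ifPn.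
apply/seteqP; split => [t /=|t /= [[At ftx]|[At x0]]].
- by case: ifP => [/set_mem|/negP tA]; [left|right; split => // /mem_set].
- by rewrite mem_set.
- by rewrite memNset.
Qed.

Lemma simple_restrict (A : set T) (f : T -> X) : measurable A -> mu_simple mu f ->
  mu_simple mu (fun t => if t \in A then f t else 0).
Proof.
move=> mA sf; have [ff mf muf] := sf; split.
- apply: (@sub_finite_set _ _ (range f `|` [set 0])).
    by move=> _ [t _ <-]; case: ifP => _; [left; exists t|right].
  by rewrite finite_setU; split => //; exact: finite_set1.
- by move=> x; exact: measurable_restrict_preimage.
- apply: le_lt_trans muf; apply: le_measure; rewrite ?inE.
  + rewrite (_ : [set _ | _] = A `&` f @^-1` [set x | x != 0]).
      by apply: measurableI => //; exact: (simple_preimage _ sf).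
    apply/seteqP; split => [t /=|t /= [At]]; last by rewrite mem_set.
    by case: ifP => [/set_mem|_]; [|rewrite eqxx].
  + exact: (simple_preimage [set x | x != 0] sf).
  + by move=> t /=; case: ifP => //; rewrite eqxx.
Qed.

(** Restricting the approximating simple functions to [A] approximates the
    restriction at least as well. *)
Lemma bochner_restrict (A : set T) (f : bochner) : measurable A ->
  exists g : bochner, val g = fun t => if t \in A then val f t else 0.
Proof.
move=> mA; apply: bochner_of; have [[f_ [sf ff]] [h_ [sh hh]]] := bochner_funP f.
have sm : strongly_measurable mu (fun t => if t \in A then val f t else 0).
  exists (fun n t => if t \in A then f_ n t else 0); split.
    by move=> n; exact: simple_restrict.
  by apply: filterS ff => t ft; case: ifP => // _; exact: cvg_cst.
split => //; exists (fun n t => if t \in A then h_ n t else 0); split.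
  by move=> n; exact: simple_restrict.
apply: (squeeze_cvge (f := fun=> 0%E) _ _ hh); [apply: nearW|exact: cvg_cst] => n.
apply/andP; split.
  by apply: integral_ge0 => t _; rewrite lee_fin rnorm_ge0.
apply: ge0_le_integral => //.
- by move=> t _; rewrite lee_fin rnorm_ge0.
- apply: (strongly_measurable_rnorm cmu); apply: strongly_measurableB => //.
  by apply: strongly_measurable_simple; exact: simple_restrict.
- apply: (strongly_measurable_rnorm cmu); apply: strongly_measurableB.
    exact: (bochner_funP f).1.
  exact: strongly_measurable_simple.
- move=> t _; rewrite lee_fin; case: ifP => // _.
  by rewrite subrr rnorm0 rnorm_ge0.
Qed.

Lemma simple_indic (A : set T) (x : X) : measurable A -> (mu A < +oo)%E ->
  mu_simple mu (fun t => if t \in A then x else 0).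
Proof.
move=> mA fA; split.
- apply: (@sub_finite_set _ _ ([set x] `|` [set 0])).
    by move=> _ [t _ <-]; case: ifP => _; [left|right].
  by rewrite finite_setU; split; exact: finite_set1.
- move=> y; apply: (@measurable_restrict_preimage A (fun=> x)) => //.
  by rewrite preimage_cst; case: ifPn.
- apply: le_lt_trans fA; apply: le_measure; rewrite ?inE//.
  + have [->|x0] := eqVneq x 0.
      rewrite (_ : [set _ | _] = set0)//; apply/seteqP; split => // t /=.
      by rewrite if_same eqxx.
    rewrite (_ : [set _ | _] = A)//; apply/seteqP; split => t /=.
      by case: ifP => [/set_mem//|_]; rewrite eqxx.
    by move=> At; rewrite mem_set.
  + by move=> t /=; case: ifP => [/set_mem//|_]; rewrite eqxx.
Qed.

Lemma indicator_embedding (A : set T) : measurable A -> (mu A < +oo)%E ->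
  exists iota : {linear X -> bochner},
    forall x, val (iota x) = fun t => if t \in A then x else 0.
Proof.
move=> mA fA; have /choice[iota iotaE] x : exists g : bochner,
    val g = fun t => if t \in A then x else 0.
  by apply: bochner_of; apply: simple_bochner; exact: simple_indic.
have iota_lin : linear iota.
  move=> a x y; apply/val_inj/funext => t.
  rewrite -[RHS]/(a *: val (iota x) t + val (iota y) t) !iotaE; case: ifP => // _.
  by rewrite scaler0 addr0.
by exists (HB.pack_for {linear X -> bochner} iota
  (GRing.isLinear.Build _ _ _ _ iota iota_lin)).
Qed.

End L1_facts.

(** * Atomless measures *)

Section density_measure.
Context d (T : measurableType d) (R : realType) (mu : {measure set T -> \bar R}).
Variable cmu : measure_is_complete mu.
Context (s : scalar_kind) (X : normedModType (scalar_field R s)).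
Variable f : bochner_fun cmu X.

(** The measure with density [|f|]. *)
Definition mass (A : set T) : \bar R := (\int[mu]_(t in A) (rnorm (val f t))%:E)%E.

Let mass0 : mass set0 = 0%E.
Proof. by rewrite /mass integral_set0. Qed.

Let mass_ge0 A : (0 <= mass A)%E.
Proof. by apply: integral_ge0 => t _; rewrite lee_fin rnorm_ge0. Qed.

Let mass_sigma_additive : semi_sigma_additive mass.
Proof.
move=> A mA tA mUA; rewrite /mass ge0_integral_bigcup//; last 2 first.
- by apply: measurable_funTS; exact: rnorm_bochner_measurable.
- by move=> t _; rewrite lee_fin rnorm_ge0.
apply: is_cvg_ereal_nneg_natsum_cond => n _ _; exact: mass_ge0.
Qed.

HB.instance Definition _ := isMeasure.Build _ _ _
  mass mass0 mass_ge0 mass_sigma_additive.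

Lemma mass_setT : mass setT = (rnorm (class_of f))%:E.
Proof. by rewrite rnorm_class. Qed.

Lemma mass_null (B : set T) : measurable B -> B `<=` [set t | val f t != 0] ->
  mass B = 0%E -> mu B = 0%E.
Proof.
move=> mB Bf0 mB0.
have mf : measurable_fun B (fun t => (rnorm (val f t))%:E).
  by apply: measurable_funTS; exact: rnorm_bochner_measurable.
have /(ae_eq_integral_abs mu mB mf) [N [mN N0 BN]] :
    (\int[mu]_(t in B) `|(rnorm (val f t))%:E| = 0)%E.
  rewrite -[RHS]mB0; apply: eq_integral => t _.
  by rewrite gee0_abs// lee_fin rnorm_ge0.
apply: (subset_measure0 mB mN _ N0) => t Bt; apply: BN => /= h.
have [/rnorm_eq0 ft0] := h Bt.
by have := Bf0 _ Bt; rewrite /= ft0 eqxx.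
Qed.

Lemma measurable_support : measurable [set t | val f t != 0].
Proof.
have -> : [set t | val f t != 0] = (fun t => (rnorm (val f t))%:E) @^-1` (~` [set 0%E]).
  apply/seteqP; split => t /= ft0.
    by move=> [/rnorm_eq0 ft]; rewrite ft eqxx in ft0.
  by apply/eqP => ft; apply: ft0; rewrite ft rnorm0.
rewrite -[_ @^-1` _]setTI; apply: rnorm_bochner_measurable => //.
by apply: measurableC; exact: emeasurable_set1.
Qed.

(** Where [f] does not vanish the two measures have the same null sets, so an
    atom of the mass meets the support of [f] in an atom of [mu]. *)
Lemma mass_atomless : atomless mu -> atomless mass.
Proof.
move=> noatom A [mA A0 Aatom]; pose A' := A `&` [set t | val f t != 0].
have mA' : measurable A' by apply: measurableI => //; exact: measurable_support.
apply: (noatom A'); split => //.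
- rewrite lt_neqAle measure_ge0 andbT; apply/negP => /eqP A'0.
  suff h : mass A = 0%E by move: A0; rewrite -[X in (0 < X)%E]/(mass A) h ltxx.
  rewrite (_ : mass A = mass A').
    by apply: null_set_integral => //; apply: measurable_funTS; exact: rnorm_bochner_measurable.
  rewrite /mass [LHS]integral_mkcond [RHS]integral_mkcond; apply: eq_integral => t _.
  rewrite !patchE in_setI; case: (boolP (t \in A)) => //= tA.
  case: ifP => // /negbT/negP tf.
  have [->|ft0] := eqVneq (val f t) 0; first by rewrite rnorm0.
  by exfalso; apply: tf; rewrite inE.
- move=> B mB BA'.
  have BA : B `<=` A by move=> t /BA' [].
  have Bf : B `<=` [set t | val f t != 0] by move=> t /BA' [].
  have [B0|AB0] := Aatom B mB BA; first by left; exact: mass_null.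
  right; apply: mass_null; first exact: measurableD.
    by move=> t [[]].
  apply/eqP; rewrite eq_le mass_ge0 andbT -[X in (_ <= X)%E]AB0.
  apply: le_measure; rewrite ?inE; try exact: measurableD.
  by apply: setSD => t [].
Qed.

End density_measure.

Section atomless_L1.
Context d (T : measurableType d) (R : realType) (mu : {measure set T -> \bar R}).
Variable cmu : measure_is_complete mu.
Context (s : scalar_kind) (X : normedModType (scalar_field R s)).
Notation sc := (scalar_of s).
Notation bochner := (bochner_fun cmu X).
Notation L1 := (L1 cmu X).

(** The average of [m] normalised pieces is [k f] with [k >= 0] and
    [int k |f| = 1].  With [n] twice the number of selected pieces containing
    [t], counted with multiplicity, [1 + k <= |1 - k| + n] pointwise; the mass of
    [n] is at most [2 m q = e / 2], and integration gives [|f - k f| >= 2 - e / 2]. *)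
Lemma atomless_DD_point : atomless mu -> forall z : L1, rnorm z = 1 -> DD_point z.
Proof.
move=> noatom z z1; split => [|I phi e e0]; first by rewrite z1.
have [m m0 mP] := empirical_approximation phi e0.
pose f := repr z; have fz : class_of f = z by exact: class_of_repr.
have m0' : 0 < m%:R :> R by rewrite ltr0n.
pose q := e / 4 / m%:R.
have q0 : 0 < q by rewrite !divr_gt0.
have fin : (mass f setT < +oo)%E by rewrite mass_setT ltry.
have [J [A [mA Aq A1]]] := atomless_partition fin (mass_atomless noatom) q0.
have /choice[fA fAE] j : exists g : bochner, val g = fun t => if t \in A j then val f t else 0.
  exact: bochner_restrict.
pose lam j := rnorm (class_of (fA j)).
have mf := rnorm_bochner_measurable f.
have lamE j : (lam j)%:E = mass f (A j).
  rewrite /lam rnorm_class /mass [RHS]integral_mkcond; apply: eq_integral => t _.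
  by rewrite patchE fAE; case: ifP => //; rewrite rnorm0.
have lam0 j : 0 <= lam j by exact: rnorm_ge0.
have lamq j : lam j <= q by rewrite -lee_fin lamE; exact: Aq.
have weighted (l : seq J) (c : J -> R) : (forall j, 0 <= c j) ->
    (\int[mu]_t ((\sum_(j <- l) c j * \1_(A j) t) * rnorm (val f t))%:E =
     (\sum_(j <- l) c j * lam j)%:E)%E.
  move=> c0; rewrite integral_weighted//; last by move=> t; exact: rnorm_ge0.
  by rewrite -sumEFin; apply: eq_bigr => j _; rewrite EFinM lamE.
have lam1 : \sum_j lam j = 1.
  apply: EFin_inj; rewrite -[in RHS]z1 -fz rnorm_class.
  have := weighted (index_enum J) (fun=> 1) (fun=> ler01).
  under eq_integral do under eq_bigr do rewrite mul1r.
  under eq_integral do rewrite A1 mul1r.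
  by move=> ->; congr EFin; apply: eq_bigr => j _; rewrite mul1r.
pose u j := sc (lam j)^-1 *: class_of (fA j).
have uE j : sc (lam j) *: u j = class_of (fA j).
  have [lj|lj] := eqVneq (lam j) 0; last first.
    by rewrite scalerA -scalar_ofM mulfV// scalar_of1 scale1r.
  by rewrite lj scalar_of0 scale0r (rnorm_eq0 lj).
have indE j t : val (fA j) t = sc (\1_(A j) t) *: val f t.
  rewrite fAE indicE; case: (t \in A j); first by rewrite scalar_of1 scale1r.
  by rewrite scalar_of0 scale0r.
have valE (l : seq J) (c : J -> R) t : val (\sum_(j <- l) sc (c j) *: fA j) t =
    sc (\sum_(j <- l) c j * \1_(A j) t) *: val f t.
  rewrite bochner_val_sum (big_morph sc (@scalar_ofD R s) (scalar_of0 R s)).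
  rewrite scaler_suml; apply: eq_bigr => j _.
  by rewrite -[LHS]/(sc (c j) *: val (fA j) t) indE scalerA scalar_ofM.
have sumu : \sum_j sc (lam j) *: u j = z.
  under eq_bigr do rewrite uE.
  rewrite -(linear_sum (@class_of _ _ _ _ cmu s X)) -fz; congr class_of.
  apply/val_inj/funext => t.
  rewrite (eq_bigr (fun j => sc 1 *: fA j)); last by move=> j _; rewrite scalar_of1 scale1r.
  rewrite valE; under eq_bigr do rewrite mul1r.
  by rewrite A1 scalar_of1 scale1r.
have u1 j : 0 < lam j -> rnorm (u j) <= 1.
  by move=> lj; rewrite rnormZ_of gtr0_norm ?invr_gt0// mulVf// gt_eqF.
have [|l [lm l0 lphi]] := mP J lam u lam0 lam1 u1; first by rewrite sumu z1.
rewrite sumu in lphi.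
have suml1 (a : R) : \sum_(j <- l) a = m%:R * a.
  by rewrite big_const_seq count_predT lm iter_addr addr0 mulr_natl.
pose c j := m%:R^-1 * (lam j)^-1.
have c0 j : 0 <= c j by rewrite mulr_ge0// invr_ge0// ltW.
pose h : bochner := \sum_(j <- l) sc (c j) *: fA j.
have hE : class_of h = sc m%:R^-1 *: \sum_(j <- l) u j.
  rewrite linear_sum scaler_sumr; apply: eq_bigr => j _.
  by rewrite linearZ scalerA -scalar_ofM.
exists (sc m%:R^-1 *: \sum_(j <- l) u j); split => //.
  rewrite rnormZ_of gtr0_norm ?invr_gt0// mulrC ler_pdivrMr// mul1r.
  apply: le_trans (rnorm_sum _ _ _) _.
  rewrite big_seq; apply: (le_trans (ler_sum _ (fun j jl => u1 j (l0 j jl)))).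
  by rewrite -big_seq suml1 mulr1.
rewrite -hE -{1}fz -linearB.
pose k t := \sum_(j <- l) c j * \1_(A j) t.
have k0 t : 0 <= k t by apply: sumr_ge0 => j _; rewrite mulr_ge0.
pose n t := \sum_(j <- l) 2 * \1_(A j) t : R.
have n0 t : 0 <= n t by apply: sumr_ge0 => j _; rewrite mulr_ge0.
have mw (c' : J -> R) : measurable_fun setT
    (fun t => ((\sum_(j <- l) c' j * \1_(A j) t) * rnorm (val f t))%:E).
  under eq_fun do rewrite EFinM.
  apply: emeasurable_funM => //; apply/measurable_EFinP.
  apply: measurable_sum => j; apply: measurable_funM => //.
have valfh t : val (f - h) t = sc (1 - k t) *: val f t.
  rewrite -[LHS]/(val f t - val h t) valE.
  by rewrite scalar_ofD scalar_ofN scalar_of1 scalerBl scale1r.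
have key : (\int[mu]_t (rnorm (val f t))%:E + \int[mu]_t (k t * rnorm (val f t))%:E <=
   \int[mu]_t (rnorm (val (f - h) t))%:E + \int[mu]_t (n t * rnorm (val f t))%:E)%E.
  have nneg (g : bochner) t : setT t -> (0 <= (rnorm (val g t))%:E)%E.
    by move=> _; rewrite lee_fin rnorm_ge0.
  have wneg (c' : T -> R) t : (forall t, 0 <= c' t) -> setT t ->
      (0 <= (c' t * rnorm (val f t))%:E)%E.
    by move=> c'0 _; rewrite lee_fin mulr_ge0// rnorm_ge0.
  rewrite -!ge0_integralD//; try exact: rnorm_bochner_measurable;
    try exact: mw; try exact: nneg; try (by move=> t; exact: wneg).
  apply: ge0_le_integral => //.
  - by move=> t _; rewrite -EFinD lee_fin addr_ge0 ?mulr_ge0 ?rnorm_ge0.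
  - by apply: emeasurable_funD; [exact: rnorm_bochner_measurable|exact: mw].
  - by apply: emeasurable_funD; [exact: rnorm_bochner_measurable|exact: mw].
  move=> t _; rewrite -!EFinD lee_fin valfh rnormZ_of.
  rewrite -[X in X + _ <= _]mul1r -!mulrDl ler_wpM2r ?rnorm_ge0//.
  (* either no selected piece contains [t], or at least one does *)
  have [[-> ->]|n2] : (k t = 0 /\ n t = 0) \/ 2 <= n t.
  - rewrite /k /n; elim: (l) => [|j r IH]; first by left; rewrite !big_nil.
    rewrite !big_cons indicE; case: (t \in A j).
      right; rewrite mulr1 lerDl; apply: sumr_ge0 => i _.
      by rewrite mulr_ge0.
    by rewrite !mulr0 !add0r.
  - by rewrite subr0 normr1.
  - by have := ler_norm (- (1 - k t)); rewrite normrN; lra.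
move: key; rewrite -!rnorm_class (weighted l c c0) (weighted l (fun=> 2) _)//.
rewrite -!EFinD lee_fin fz z1.
have -> : \sum_(j <- l) c j * lam j = 1.
  rewrite (eq_big_seq (fun=> m%:R^-1)) ?suml1 ?mulfV ?gt_eqF//.
  by move=> j /l0 lj; rewrite -mulrA mulVf ?mulr1// gt_eqF.
have : \sum_(j <- l) 2 * lam j <= e / 2.
  apply: (@le_trans _ _ (\sum_(j <- l) 2 * q)).
    by apply: ler_sum => j _; rewrite ler_pM2l.
  rewrite suml1 /q (_ : m%:R * _ = e / 2)//.
  by field; rewrite gt_eqF.
by lra.
Qed.

End atomless_L1.

(** * Simple functions *)

Section finite_positive_sets.
Context d (T : measurableType d) (R : realType) (mu : {measure set T -> \bar R}).

Lemma exists_finite_positive (A : set T) : sigma_finite [set: T] mu ->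
  measurable A -> (0 < mu A)%E ->
  exists B, [/\ measurable B, B `<=` A, (0 < mu B)%E & (mu B < +oo)%E].
Proof.
move=> [F TF FP] mA A0; apply: contrapT => nB.
have AF0 n : mu (A `&` F n) = 0%E.
  have [mF Ffin] := FP n.
  have mAF : measurable (A `&` F n) by exact: measurableI.
  apply/eqP; apply: contraT => AF; exfalso; apply: nB; exists (A `&` F n); split => //.
    by rewrite lt_neqAle eq_sym AF measure_ge0.
  by apply: le_lt_trans Ffin; apply: le_measure; rewrite ?inE.
have : mu.-negligible (\bigcup_n (A `&` F n)).
  apply: negligible_bigcup => n; exists (A `&` F n); split => //.
  by apply: measurableI => //; exact: (FP n).1.
rewrite -setI_bigcupr -TF setIT => /(negligibleP mu mA) A0'.
by rewrite A0' ltxx in A0.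
Qed.

Lemma ae_witness (A : set T) (Q : T -> Prop) : measurable A -> (0 < mu A)%E ->
  {ae mu, forall t, A t -> Q t} -> exists2 t, A t & Q t.
Proof.
move=> mA A0 [N [mN N0 NQ]]; apply: contrapT => nt.
have : mu A = 0%E; last by move=> A0'; rewrite A0' ltxx in A0.
apply: (subset_measure0 mA mN _ N0) => t At; apply: NQ => /= h.
by apply: nt; exists t => //; exact: h.
Qed.

End finite_positive_sets.

Section simple_approximation.
Context d (T : measurableType d) (R : realType) (mu : {measure set T -> \bar R}).
Variable cmu : measure_is_complete mu.
Context (s : scalar_kind) (X : normedModType (scalar_field R s)).
Notation sc := (scalar_of s).
Notation bochner := (bochner_fun cmu X).
Notation L1 := (L1 cmu X).

Lemma rnorm_sum_disjoint (J : finType) (P : pred J) (y : J -> X) :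
  (forall i j, P i -> P j -> i = j) ->
  rnorm (\sum_j if P j then y j else 0) = \sum_j if P j then rnorm (y j) else 0.
Proof.
move=> Puniq; have [j Pj|P0] := pickP P; last first.
  by rewrite !big1 ?rnorm0// => j _; rewrite P0.
rewrite (bigD1 j)//= [RHS](bigD1 j)//= Pj.
have off i : i != j -> P i = false.
  by move=> ij; apply: contra_neqF ij => /Puniq; exact.
by rewrite !big1 ?addr0// => i /off ->.
Qed.

(** Functions constant on the disjoint sets [A j] form a weighted l1-sum.  The
    set [E] only witnesses that the weights do not all vanish. *)
Lemma indicator_l1_embedding (J : finType) (A : J -> set T) (E : set T) :
  (forall j, measurable (A j)) -> (forall j, (mu (A j) < +oo)%E) ->
  (forall i j t, t \in A i -> t \in A j -> i = j) ->
  measurable E -> (0 < mu E)%E -> E `<=` \bigcup_j A j ->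
  exists2 iota : J -> {linear X -> bochner},
    forall j x, val (iota j x) = fun t => if t \in A j then x else 0 &
    l1_embedding (fun j => fine (mu (A j)))
      (fun j => [the {linear X -> L1} of @class_of _ _ _ _ cmu _ _ \o iota j]).
Proof.
move=> mA fA Adisj mE E0 EA.
have /choice[iota iotaE] j : exists iota : {linear X -> bochner},
    forall x, val (iota x) = fun t => if t \in A j then x else 0.
  exact: indicator_embedding.
have muA j : (fine (mu (A j)))%:E = mu (A j) by rewrite fineK// ge0_fin_numE.
have weighted (c : J -> R) : (forall j, 0 <= c j) ->
    (\int[mu]_t (\sum_j if t \in A j then c j else 0)%:E =
     (\sum_j fine (mu (A j)) * c j)%:E)%E.
  move=> c0; have := integral_weighted mu (index_enum J) mA c0 (fun=> ler01)
    (@measurable_cst _ _ _ _ _ _).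
  under eq_integral => t _.
    rewrite mulr1; under eq_bigr => j _ do
      rewrite indicE mulr_natr mulrb.
    over.
  move=> ->; rewrite -sumEFin; apply: eq_bigr => j _.
  by rewrite integral_cst// mul1e -muA -EFinM mulrC.
exists iota => //; split.
- by move=> j; exact: fine_ge0.
- have := weighted (fun=> 1) (fun=> ler01).
  under [in X in _ -> X]eq_bigr do rewrite -[fine _]mulr1.
  rewrite -lte_fin => <-; apply: lt_le_trans E0 _.
  rewrite -(setIT E) -integral_indic//; apply: ge0_le_integral => //.
  + by apply/measurable_EFinP; exact: measurable_indic.
  + apply/measurable_EFinP; apply: measurable_sum => j.
    rewrite (_ : (fun _ => _) = \1_(A j)); first exact: measurable_indic.
    by apply/funext => t; rewrite indicE; case: (t \in A j).
  + move=> t _; rewrite lee_fin indicE; have [tE|_] := boolP (t \in E); last first.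
      by apply: sumr_ge0 => j _; case: ifP.
    have [j _ Ajt] := EA t (set_mem tE).
    rewrite (bigD1 j)//= mem_set// lerDl; apply: sumr_ge0 => i _; by case: ifP.
- move=> y; apply: EFin_inj; rewrite -weighted; last by move=> j; exact: rnorm_ge0.
  rewrite -(linear_sum (@class_of _ _ _ _ cmu s X)) rnorm_class; apply: eq_integral => t _.
  rewrite bochner_val_sum; under eq_bigr do rewrite iotaE.
  by rewrite rnorm_sum_disjoint// => i j; exact: Adisj.
Qed.

(** Scaling a good simple approximation by [1 / (1 + q)] brings it into the ball. *)
Lemma simple_approximation (z : L1) (e : R) : rnorm z <= 1 -> 0 < e ->
  exists h : bochner, [/\ mu_simple mu (val h), rnorm (class_of h) <= 1 &
    rnorm (z - class_of h) < e].
Proof.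
move=> z1 e0; pose f := repr z; have fz : class_of f = z by exact: class_of_repr.
have [_ [f_ [sf ff]]] := bochner_funP f.
have e20 : 0 < e / 2 by rewrite divr_gt0.
have [g [sg gz]] : exists g : bochner, mu_simple mu (val g) /\ rnorm (z - class_of g) < e / 2.
  move: ff => /fine_cvgP[fin /cvgrPdist_lt/(_ _ e20) lt].
  have [n [finn ltn]] : exists n, (\int[mu]_t (rnorm (val f t - f_ n t))%:E)%E \is a fin_num /\
    `|0 - fine (\int[mu]_t (rnorm (val f t - f_ n t))%:E)%E| < e / 2.
    by have [n _ h] := filterI fin lt; exists n; exact: (h n (leqnn n)).
  have [g gE] := bochner_of cmu (simple_bochner (sf n)).
  exists g; split; first by rewrite gE.
  move: ltn; rewrite sub0r normrN; apply: le_lt_trans.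
  rewrite -fz -linearB; apply: le_trans (ler_norm _); rewrite -lee_fin rnorm_class fineK//.
  by rewrite /= gE.
pose q := rnorm (z - class_of g); have q0 : 0 <= q by exact: rnorm_ge0.
have q10 : 0 < 1 + q by rewrite ltr_pwDl.
have g1 : rnorm (class_of g) <= 1 + q.
  have := ler_rnormD z (class_of g - z); rewrite addrC subrK rnorm_distC -/q.
  by move: z1; lra.
exists (sc (1 + q)^-1 *: g); split.
- exact: simpleZ.
- by rewrite linearZ rnormZ_of gtr0_norm ?invr_gt0// mulrC ler_pdivrMr// mul1r.
- rewrite linearZ; set G := class_of g.
  have -> : z - sc (1 + q)^-1 *: G = (z - G) + sc (q / (1 + q)) *: G.
    have shift a b : a + b = G -> z - a = (z - G) + b.
      by move=> <-; rewrite opprD addrA subrK.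
    apply: shift; rewrite -scalerDl -scalar_ofD -[RHS]scale1r -scalar_of1.
    by congr (sc _ *: _); field; rewrite gt_eqF.
  apply: le_lt_trans (ler_rnormD _ _) _.
  have : rnorm (sc (q / (1 + q)) *: G) <= q.
    rewrite rnormZ_of ger0_norm ?divr_ge0 ?(ltW q10)//.
    by rewrite mulrAC ler_pdivrMr// ler_wpM2l.
  by move: gz; rewrite -/q -/G; lra.
Qed.

(** The level sets of a simple function, cut down to its support to have finite
    measure; the support is enlarged by [E] because it may be null. *)
Lemma L1_l1_approx : sigma_finite [set: T] mu -> (0 < mu [set: T])%E ->
  forall (z : L1) (e : R), rnorm z <= 1 -> 0 < e ->
  exists (J : finType) (alpha : J -> R) (iota : J -> {linear X -> L1}) (a : J -> X),
     [/\ l1_embedding alpha iota, rnorm (\sum_j iota j (a j)) <= 1 &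
         rnorm (z - \sum_j iota j (a j)) < e].
Proof.
move=> sfmu mu0 z e z1 e0.
have [h [sh h1 hz]] := simple_approximation z1 e0.
have [E [mE _ E0 Efin]] := exists_finite_positive sfmu measurableT mu0.
have [/finite_seqP[r rE] mh hfin] := sh.
pose H := [set t | val h t != 0]; pose J : finType := seq_sub r.
have mH : measurable H by exact: (simple_preimage [set x | x != 0] sh).
pose A (j : J) := val h @^-1` [set ssval j] `&` (E `|` H).
have mA j : measurable (A j) by apply: measurableI => //; exact: measurableU.
have fA j : (mu (A j) < +oo)%E.
  apply: (@le_lt_trans _ _ (mu E + mu H)%E); last exact: lte_add_pinfty.
  apply: le_trans (measureU2 mu mE mH); apply: le_measure; rewrite ?inE//.
    exact: measurableU.
  exact: subIsetr.
have in_r t : val h t \in r.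
  by have : range (val h) (val h t); [exists t|rewrite rE].
have Adisj (j1 j2 : J) (t : T) : t \in A j1 -> t \in A j2 -> j1 = j2.
  by rewrite !inE => -[/= hi _] [/= hj _]; apply/val_inj; rewrite /= -hi.
have EA : E `<=` \bigcup_j A j.
  by move=> t Et; exists (SeqSub (in_r t)) => //; split => //; left.
have [iota iotaE l1] := indicator_l1_embedding mA fA Adisj mE E0 EA.
have hE : \sum_j class_of (iota j (ssval j)) = class_of h.
  rewrite -(linear_sum (@class_of _ _ _ _ cmu s X)); congr class_of.
  apply/val_inj/funext => t; rewrite bochner_val_sum.
  under eq_bigr do rewrite iotaE.
  have [tEH|tEH] := pselect ((E `|` H) t); last first.
    rewrite big1 => [|j _]; first by apply/esym/eqP/negPn/negP => ht; apply: tEH; right.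
    by rewrite memNset// => -[].
  rewrite (bigD1 (SeqSub (in_r t)))//= mem_set// big1 ?addr0// => j jt.
  rewrite memNset// => -[/= hj _]; move/eqP: jt; apply.
  by apply/val_inj; rewrite /= hj.
exists J, (fun j => fine (mu (A j))),
  (fun j => [the {linear X -> L1} of @class_of _ _ _ _ cmu _ _ \o iota j]), (fun j => ssval j).
by split => //=; rewrite hE.
Qed.

End simple_approximation.

(** * Atoms *)

Section atoms.
Context d (T : measurableType d) (R : realType) (mu : {measure set T -> \bar R}).
Variable cmu : measure_is_complete mu.
Context (s : scalar_kind) (X : normedModType (scalar_field R s)).
Notation sc := (scalar_of s).
Notation bochner := (bochner_fun cmu X).
Notation L1 := (L1 cmu X).

(** One of the finitely many level sets fills the atom. *)
Lemma simple_atom_constant (A : set T) (f : T -> X) : atom mu A -> mu_simple mu f ->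
  exists x, {ae mu, forall t, A t -> f t = x}.
Proof.
move=> [mA A0 Aatom] [/finite_seqP[r rE] mf _].
have mAf x : measurable (A `&` f @^-1` [set x]) by exact: measurableI.
have [x Ax] : exists x, mu (A `\` (A `&` f @^-1` [set x])) = 0%E.
  apply: contrapT => nx.
  have Ax0 x : mu (A `&` f @^-1` [set x]) = 0%E.
    have [//|Ax] := Aatom _ (mAf x) (@subIsetl _ _ _).
    by exfalso; apply: nx; exists x.
  have : mu.-negligible (\bigcup_n (A `&` f @^-1` [set r`_n])).
    by apply: negligible_bigcup => n; exists (A `&` f @^-1` [set r`_n]); split.
  suff -> : \bigcup_n (A `&` f @^-1` [set r`_n]) = A.
    by move=> /(negligibleP mu mA) A0'; rewrite A0' ltxx in A0.
  apply/seteqP; split => [t [n _ []]//|t At].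
  have ftr : f t \in r by have : range f (f t); [exists t|rewrite rE].
  by exists (index (f t) r) => //; split => //=; rewrite nth_index.
exists x, (A `\` (A `&` f @^-1` [set x])); split => //.
  exact: measurableD.
by move=> t /= /not_implyP[At ft]; split => // -[].
Qed.

(** The constants of the approximating simple functions converge, since they do
    so at almost every point of the atom. *)
Lemma atom_constant (A : set T) (f : T -> X) : atom mu A -> strongly_measurable mu f ->
  exists x, {ae mu, forall t, A t -> f t = x}.
Proof.
move=> aA [f_ [sf ff]]; have [mA A0 _] := aA.
have /choice[x_ xE] n := simple_atom_constant aA (sf n).
have all_n : {ae mu, forall t, A t -> (forall n, f_ n t = x_ n) /\ f_ ^~ t @ \oo --> f t}.
  have : {ae mu, forall t, forall n, A t -> f_ n t = x_ n} by exact/ae_foralln.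
  by apply: filterS2 ff => t ft At_f At; split => // n; exact: At_f.
have [t0 At0 [ft0 cv0]] := ae_witness mA A0 all_n.
exists (f t0); apply: filterS all_n => t Aft At; have [ft cv] := Aft At.
have f_eq : f_ ^~ t = f_ ^~ t0 by apply/funext => n; rewrite ft ft0.
rewrite f_eq in cv; exact: (cvg_unique _ cv cv0).
Qed.

Definition atom_value (A : set T) (z : L1) : X :=
  xget 0 [set x | {ae mu, forall t, A t -> val (repr z) t = x}].

Lemma atom_value_class (A : set T) (f : bochner) (x : X) : atom mu A ->
  {ae mu, forall t, A t -> val f t = x} -> atom_value A (class_of f) = x.
Proof.
move=> [mA A0 _] fx.
have rf : {ae mu, forall t, val (repr (class_of f)) t = val f t}.
  by apply/L1_eqP; rewrite -[RHS]/(class_of f) -[LHS]/(class_of _) class_of_repr.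
have rx : {ae mu, forall t, A t -> val (repr (class_of f)) t = x}.
  by apply: filterS2 rf fx => t -> h /h.
rewrite /atom_value; case: xgetP => [y _ /= ry|/(_ x)//].
have : {ae mu, forall t, A t -> x = y}.
  by apply: filterS2 rx ry => t hx hy At; rewrite -(hx At); exact: hy.
by move=> /(ae_witness mA A0)[].
Qed.

Lemma atom_valueP (A : set T) (z : L1) : atom mu A ->
  {ae mu, forall t, A t -> val (repr z) t = atom_value A z}.
Proof.
move=> aA; have [x xP] := atom_constant aA (bochner_funP (repr z)).1.
have := atom_value_class aA xP; rewrite class_of_repr => ->.
exact: xP.
Qed.

Lemma atom_value_linear (A : set T) : atom mu A -> linear (atom_value A).
Proof.
move=> aA a u v; rewrite -{1}(class_of_repr u) -{1}(class_of_repr v) -linearP.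
apply: atom_value_class => //.
apply: filterS2 (atom_valueP u aA) (atom_valueP v aA) => t uP vP At.
by rewrite -[LHS]/(a *: val (repr u) t + val (repr v) t) uP// vP.
Qed.

(** The weights [a^-1] and [a], for [a] the measure of the atom, make the
    embedding isometric.  The norm identity holds pointwise almost everywhere:
    on the atom [f] is its value [x] and [f - x 1_A] vanishes, elsewhere [f] and
    [f - x 1_A] agree. *)
Lemma atom_L_summand (A : set T) : atom mu A -> (mu A < +oo)%E ->
  exists (J : {linear X -> L1}) (P : {linear L1 -> X}),
    cancel J P /\ forall z, rnorm z = rnorm (P z) + rnorm (z - J (P z)).
Proof.
move=> aA fA; have [mA A0 _] := aA.
have [iota iotaE] := indicator_embedding cmu X mA fA.
pose a := fine (mu A).
have aE : a%:E = mu A by rewrite fineK// ge0_fin_numE.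
have a0 : 0 < a by rewrite -lte_fin aE.
pose J' x : L1 := class_of (iota (sc a^-1 *: x)).
have J'lin : linear J' by move=> c x y; rewrite /J' scalerDr scalerA mulrC -scalerA !linearP.
pose P' z : X := sc a *: atom_value A z.
have P'lin : linear P'.
  by move=> c x y; rewrite /P' (atom_value_linear aA) scalerDr scalerA mulrC -scalerA.
have asc x : sc a^-1 *: (sc a *: x) = x.
  by rewrite scalerA -scalar_ofM mulVf ?gt_eqF// scalar_of1 scale1r.
exists (HB.pack_for {linear X -> L1} J' (GRing.isLinear.Build _ _ _ _ J' J'lin)).
exists (HB.pack_for {linear L1 -> X} P' (GRing.isLinear.Build _ _ _ _ P' P'lin)).
split => [x|z] /=.
  rewrite /P' /J' (@atom_value_class A _ (sc a^-1 *: x))//.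
    by rewrite scalerA -scalar_ofM mulfV ?gt_eqF// scalar_of1 scale1r.
  by apply: aeW => t At; rewrite iotaE mem_set.
rewrite /J' asc; set x := atom_value A z; set f := repr z.
have -> : z - class_of (iota x) = class_of (f - iota x).
  by rewrite linearB /= /f class_of_repr.
apply: EFin_inj; rewrite EFinD rnormZ_of gtr0_norm//.
rewrite -{1}(class_of_repr z) !rnorm_class -/f.
have -> : (a * rnorm x)%:E = (\int[mu]_t (rnorm x * \1_A t)%:E)%E.
  under eq_integral do rewrite EFinM.
  rewrite ge0_integralZl ?lee_fin ?rnorm_ge0//; last first.
    by apply/measurable_EFinP; exact: measurable_indic.
  by rewrite integral_indic// setIT -aE -EFinM mulrC.
have mx : measurable_fun setT (fun t => (rnorm x * \1_A t)%:E).
  apply/measurable_EFinP; apply: measurable_funM => //; exact: measurable_indic.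
rewrite -ge0_integralD//; last 3 first.
- by move=> t _; rewrite lee_fin mulr_ge0// rnorm_ge0.
- by move=> t _; rewrite lee_fin rnorm_ge0.
- exact: rnorm_bochner_measurable.
apply: ge0_ae_eq_integral => //.
- exact: rnorm_bochner_measurable.
- by apply: emeasurable_funD => //; exact: rnorm_bochner_measurable.
- by move=> t _; rewrite lee_fin rnorm_ge0.
- by move=> t _; rewrite -EFinD lee_fin addr_ge0 ?mulr_ge0 ?rnorm_ge0.
apply: filterS (atom_valueP z aA) => t ft _.
rewrite -EFinD indicE; congr EFin.
have -> : val (f - iota x) t = val f t - val (iota x) t by [].
rewrite iotaE; case: (boolP (t \in A)) => [/set_mem tA|_].
  by rewrite mulr1 /f (ft tA) subrr rnorm0 addr0.
by rewrite mulr0 add0r subr0.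
Qed.

End atoms.

Lemma atom_subset d (T : measurableType d) (R : realType)
    (mu : {measure set T -> \bar R}) (A B : set T) :
  atom mu A -> measurable B -> B `<=` A -> (0 < mu B)%E -> atom mu B.
Proof.
move=> [mA A0 Aatom] mB BA B0; split => // C mC CB.
have [->|AC0] := Aatom C mC (subset_trans CB BA); first by left.
right; apply: (subset_measure0 _ _ _ AC0); try exact: measurableD.
exact: setSD.
Qed.

Lemma L1_neq0 d (T : measurableType d) (R : realType) (mu : {measure set T -> \bar R})
    (cmu : measure_is_complete mu) (s : scalar_kind)
    (X : normedModType (scalar_field R s)) : sigma_finite [set: T] mu ->
  (0 < mu [set: T])%E -> (exists x : X, x != 0) -> exists z : L1 cmu X, z != 0.
Proof.
move=> sfmu mu0 [x x0].
have [E [mE _ E0 Efin]] := exists_finite_positive sfmu measurableT mu0.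
have [iota iotaE] := indicator_embedding cmu X mE Efin.
exists (class_of (iota x)); apply: contra_neq x0 => cx0.
have := rnorm_class (iota x); rewrite cx0 rnorm0.
rewrite (eq_integral (fun t => (rnorm x * \1_E t)%:E)); last first.
  move=> t _; rewrite iotaE indicE; case: (t \in E); first by rewrite mulr1.
  by rewrite rnorm0 mulr0.
under eq_integral do rewrite EFinM.
rewrite ge0_integralZl ?lee_fin ?rnorm_ge0//; last first.
  by apply/measurable_EFinP; exact: measurable_indic.
rewrite integral_indic// setIT => /esym/eqP; rewrite mule_eq0 => /orP[/eqP[]|/eqP E00].
  exact: rnorm_eq0.
by rewrite E00 ltxx in E0.
Qed.

Theorem theorem4p1 (R : realType) (s : scalar_kind)
    (X : completeNormedModType (scalar_field R s)) (X_neq0 : exists x : X, x != 0)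
    (d : measure_display) (S : measurableType d)
    (mu : {measure set S -> \bar R}) (cmu : measure_is_complete mu)
    (sfmu : sigma_finite [set: S] mu) (mu_neq0 : (0 < mu [set: S])%E) :
  weak_DD2P (L1 cmu X) <-> (atomless mu \/ weak_DD2P X).
Proof.
split=> [L1DD|[mu_atomless|XDD]].
- have [|] := pselect (atomless mu); first by left.
  move=> /existsNP[A /contrapT aA]; right; have [mA A0 _] := aA.
  have [B [mB BA B0 Bfin]] := exists_finite_positive sfmu mA A0.
  have aB := atom_subset aA mB BA B0.
  have [J [P [JP normP]]] := atom_L_summand cmu X aB Bfin.
  exact: (L_summand_weak_DD2P JP normP).
- apply: weak_DD2P_of_sphere => [|I phi e z e0 z1]; last first.
    exists z; first exact: atomless_DD_point.
    by move=> i; rewrite subrr linear0 rnorm0.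
  exact: L1_neq0.
- exact: weak_DD2P_of_l1_approx XDD (L1_l1_approx sfmu mu_neq0).
Qed.
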